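(* Let $a<b$ be real numbers, $n\in\mathbb{N}$, and let $F_1,F_2\colon[a,b]\to\mathbb{R}$ be functions of bounded variation with $F_1(a)=F_2(a)$. For a function $G\colon[a,b]\to\mathbb{R}$ of bounded variation define $J_0^G=G$ and $J_k^G(x)=\int_a^x J_{k-1}^G(s)\,ds$ for $x\in[a,b]$, $k\ge 1$, so that $J_k^G(x)=\int_a^x\int_a^{x_{k-1}}\cdots\int_a^{x_1}G(t)\,dt\,dx_1\cdots dx_{k-1}$. Then $$\int_a^b f(x)\,dF_1(x)\le\int_a^b f(x)\,dF_2(x)\quad\text{for all continuous $n$-convex functions } f\colon[a,b]\to\mathbb{R}$$ holds if and only if the following conditions are satisfied: (i) $F_1(b)=F_2(b)$; (ii) $\int_a^b F_1(x)\,dx=\int_a^b F_2(x)\,dx$; (iii) $J_k^{F_1}(b)=J_k^{F_2}(b)$ for $k=2,\dots,n$; (iv) $(-1)^{n+1}J_n^{F_1}(x)\le(-1)^{n+1}J_n^{F_2}(x)$ for every $x\in(a,b)$.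
   Context: A function $f$ on an interval is called $n$-convex ($n\ge1$) in the sense of Popoviciu, i.e. all its divided differences of order $n+1$ are nonnegative; equivalently, $f^{(n-1)}$ exists and is convex (so $1$-convex means convex), and for $f$ continuous on $[a,b]$ and $(n+1)$-times differentiable on $(a,b)$ this is equivalent to $f^{(n+1)}\ge0$ on $(a,b)$. Integrals $\int f\,dF$ are Riemann–Stieltjes integrals. *)

(* Defs.v *)
From Stdlib Require Import Reals.
From Coquelicot Require Import Coquelicot.
Open Scope R_scope.

Fixpoint sumR (m : nat) (g : nat -> R) : R :=
  match m with O => 0 | S m' => sumR m' g + g m' end.
Fixpoint prodR (m : nat) (g : nat -> R) : R :=
  match m with O => 1 | S m' => prodR m' g * g m' end.

Definition divdiff (f : R -> R) (x : nat -> R) (k : nat) : R :=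
  sumR (S k) (fun i =>
    f (x i) / prodR (S k) (fun j => if Nat.eqb j i then 1 else x i - x j)).

Definition n_convex (n : nat) (f : R -> R) (a b : R) : Prop :=
  forall x : nat -> R,
    (forall i, (i < S n)%nat -> x i < x (S i)) ->
    a <= x O -> x (S n) <= b ->
    0 <= divdiff f x (S n).

Definition continuous_on_ab (f : R -> R) (a b : R) : Prop :=
  forall x, a <= x <= b -> forall eps, 0 < eps -> exists delta, 0 < delta /\
    forall y, a <= y <= b -> Rabs (y - x) < delta -> Rabs (f y - f x) < eps.

Definition is_partition (a b : R) (m : nat) (p : nat -> R) : Prop :=
  p O = a /\ p m = b /\ forall i, (i < m)%nat -> p i < p (S i).

Definition BV_on (G : R -> R) (a b : R) : Prop :=
  exists M, forall m p, is_partition a b m p ->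
    sumR m (fun i => Rabs (G (p (S i)) - G (p i))) <= M.

Definition RS_sum (f F : R -> R) (m : nat) (p t : nat -> R) : R :=
  sumR m (fun i => f (t i) * (F (p (S i)) - F (p i))).

Definition is_RSInt (f F : R -> R) (a b I : R) : Prop :=
  forall eps, 0 < eps -> exists delta, 0 < delta /\
    forall m p t, is_partition a b m p ->
      (forall i, (i < m)%nat -> p i <= t i <= p (S i)) ->
      (forall i, (i < m)%nat -> p (S i) - p i < delta) ->
      Rabs (RS_sum f F m p t - I) < eps.

Fixpoint J (k : nat) (G : R -> R) (a : R) : R -> R :=
  match k with
  | O => G
  | S k' => fun x => RInt (J k' G a) a x
  end.

(* Main.v *)
(* Put [G = F2 - F1], so [G a = 0].  Repeated integration by parts gives, for smooth [g],
   [int g dG = sum_k (-1)^k g^(k)(b) J_k G(b) + (-1)^(n+1) int g^(n+1) J_n G].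
   Necessity: testing with [(x - b)^k], which is [n]-convex together with its opposite for
   [k <= n], gives [J_k G(b) = 0]; then testing with a function whose derivative of order
   [n+1] is the negative part of [(-1)^(n+1) J_n G] forces that negative part to vanish.
   Sufficiency: under (i)-(iv) the formula is nonnegative for smooth [n]-convex [g], and
   a continuous [n]-convex function is the uniform limit of its Bernstein polynomials,
   which are [n]-convex. *)
Require Import Defs.
From Stdlib Require Import Reals Factorial Lra Lia.
From Coquelicot Require Import Coquelicot.
Open Scope R_scope.

(** Both integrations by parts are therefore read off from increments: over a cell [[x, y]] the
    defect is at most a constant times [y - x] times the variation of the integrator for the
    Stieltjes integral, and at most a constant times [(y - x) ^ 2] for primitives; summed over fine
    partitions, such defects vanish.

    The Stieltjes integral is a relation with no existence built in. Necessity thus needs test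
    functions whose integrals are known explicitly, hence of class C1; sufficiency receives the two
    integrals of [f] and compares them with those of a smooth [g] on one common partition.

    Test functions are iterated primitives based at [b], which kills the lower boundary terms. The
    negative part [h] of a continuous [w] satisfies [h * w = - h * h], so a single integral decides
    the sign of [w] at all points at once. *)

Lemma sumR_ext m g h : (forall i, (i < m)%nat -> g i = h i) -> sumR m g = sumR m h.
Proof.
  induction m as [|m IH]; simpl; intros H; [easy|].
  rewrite IH, (H m); auto with arith.
Qed.

Lemma sumR_scal m c g : sumR m (fun i => c * g i) = c * sumR m g.
Proof. induction m as [|m IH]; simpl; [lra|]; rewrite IH; lra. Qed.

Lemma sumR_minus m g h : sumR m (fun i => g i - h i) = sumR m g - sumR m h.
Proof. induction m as [|m IH]; simpl; [lra|]; rewrite IH; lra. Qed.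

Lemma sumR_le m g h : (forall i, (i < m)%nat -> g i <= h i) -> sumR m g <= sumR m h.
Proof.
  induction m as [|m IH]; simpl; intros H; [lra|].
  apply Rplus_le_compat; auto.
Qed.

Lemma sumR_abs m g : Rabs (sumR m g) <= sumR m (fun i => Rabs (g i)).
Proof.
  induction m as [|m IH]; simpl; [rewrite Rabs_R0; lra|].
  generalize (Rabs_triang (sumR m g) (g m)); lra.
Qed.

Lemma sumR_telescope m u : sumR m (fun i => u (S i) - u i) = u m - u O.
Proof. induction m as [|m IH]; simpl; [lra|]; rewrite IH; lra. Qed.

(** * Variation functions and integrability *)

(** Bounded variation through a majorant [v]: its increments telescope over partitions, and both [v]
    and [v - F] are nondecreasing, which is the Jordan decomposition. *)
Definition controlled (F v : R -> R) : Prop :=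
  forall x y, x <= y -> Rabs (F y - F x) <= v y - v x.

(** Composition with [clamp] extends a function on [[a, b]] by constants, so that variation bounds
    and continuity hold on the whole line. *)
Definition clamp (a b x : R) : R := Rmax a (Rmin b x).

Lemma clamp_in a b x : a <= b -> a <= clamp a b x <= b.
Proof. intros H; unfold clamp, Rmax, Rmin; repeat destruct Rle_dec; lra. Qed.

Lemma clamp_id a b x : a <= x <= b -> clamp a b x = x.
Proof. intros H; unfold clamp, Rmax, Rmin; repeat destruct Rle_dec; lra. Qed.

Lemma clamp_le a b x y : x <= y -> clamp a b x <= clamp a b y.
Proof. intros H; unfold clamp, Rmax, Rmin; repeat destruct Rle_dec; lra. Qed.

Lemma partition_extend a x y m p :
  is_partition a x m p -> x < y ->
  is_partition a y (S m) (fun i => if Nat.leb i m then p i else y).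
Proof.
  intros (H0 & Hm & Hp) Hxy; repeat split.
  - easy.
  - rewrite (proj2 (Nat.leb_gt (S m) m)); [easy|lia].
  - intros i Hi; rewrite (proj2 (Nat.leb_le i m)) by lia.
    destruct (Nat.leb (S i) m) eqn:E.
    + apply Nat.leb_le in E; apply Hp; lia.
    + apply Nat.leb_gt in E; replace i with m by lia; lra.
Qed.

Lemma sumR_partition_extend (G : R -> R) y m p :
  sumR (S m) (fun i => Rabs (G (if Nat.leb (S i) m then p (S i) else y)
                             - G (if Nat.leb i m then p i else y)))
  = sumR m (fun i => Rabs (G (p (S i)) - G (p i))) + Rabs (G y - G (p m)).
Proof.
  change (sumR (S m) ?g) with (sumR m g + g m); cbv beta.
  f_equal.
  - apply sumR_ext; intros i Hi.
    rewrite (proj2 (Nat.leb_le i m)), (proj2 (Nat.leb_le (S i) m)) by lia; easy.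
  - rewrite (proj2 (Nat.leb_le m m)), (proj2 (Nat.leb_gt (S m) m)) by lia; easy.
Qed.

(** [v x] is the total variation on [[a, x]]. Appending [y] to a partition of [[a, x]] adds
    [Rabs (G y - G x)] to its sum, which gives the increment bound. *)
Lemma BV_on_variation G a b :
  a <= b -> BV_on G a b ->
  exists v, forall x y, a <= x -> x <= y -> y <= b -> Rabs (G y - G x) <= v y - v x.
Proof.
  intros Hab [M HM].
  set (E := fun x s => exists m p, is_partition a x m p /\
              s = sumR m (fun i => Rabs (G (p (S i)) - G (p i)))).
  assert (Hne : forall x, a <= x -> exists s, E x s).
  { intros x Hx; destruct (Req_dec a x) as [<-|Hn].
    (* At [x = a] only the partition with no cell exists, since nodes increase strictly. *)
    - exists 0, O, (fun _ => a); repeat split; intros; lia.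
    - eexists; exists 1%nat, (fun i => match i with O => a | _ => x end).
      split; [|reflexivity]; repeat split.
      intros i Hi; replace i with O by lia; lra. }
  assert (HB : forall x, x <= b -> is_upper_bound (E x) M).
  { intros x Hx s (m & p & Hp & ->).
    destruct (Req_dec x b) as [->|Hn]; [now apply HM|].
    assert (Hxb : x < b) by lra.
    generalize (HM _ _ (partition_extend a x b m p Hp Hxb)).
    rewrite sumR_partition_extend.
    generalize (Rabs_pos (G b - G (p m))); lra. }
  assert (Hlub : forall x, a <= x <= b -> is_lub (E x) (real (Lub_Rbar (E x)))).
  { intros x Hx; destruct (Hne x) as [s Hs]; [lra|].
    destruct (completeness (E x)) as [l Hl];
      [exists M; apply HB; lra|now exists s|].
    rewrite (is_lub_Rbar_unique (E x) l); [easy|].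
    destruct Hl as [H1 H2]; split; [exact H1|].
    intros [c| |] Hc; simpl; auto.
    exact (Hc s Hs). }
  exists (fun x => real (Lub_Rbar (E x))); intros x y Hx Hxy Hy.
  destruct (Req_dec x y) as [<-|Hn].
  { rewrite !Rminus_diag, Rabs_R0; lra. }
  destruct (Hlub x) as [_ Hx2]; [lra|].
  destruct (Hlub y) as [Hy1 _]; [lra|].
  enough (real (Lub_Rbar (E x)) <= real (Lub_Rbar (E y)) - Rabs (G y - G x)) by lra.
  apply Hx2; intros s (m & p & Hp & ->).
  assert (Hlt : x < y) by lra.
  assert (HE : E y (sumR m (fun i => Rabs (G (p (S i)) - G (p i))) + Rabs (G y - G (p m)))).
  { exists (S m), (fun i => if Nat.leb i m then p i else y); split.
    - now apply partition_extend with x.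
    - symmetry; apply sumR_partition_extend. }
  apply Hy1 in HE; destruct Hp as (_ & Hpm & _); rewrite Hpm in HE; lra.
Qed.

Lemma BV_on_controlled G a b :
  a <= b -> BV_on G a b -> exists v, controlled (fun x => G (clamp a b x)) v.
Proof.
  intros Hab HG; destruct (BV_on_variation G a b Hab HG) as [v Hv].
  exists (fun x => v (clamp a b x)); intros x y Hxy; apply Hv.
  - now apply clamp_in.
  - now apply clamp_le.
  - now apply clamp_in.
Qed.

Lemma controlled_minus F1 F2 v1 v2 :
  controlled F1 v1 -> controlled F2 v2 ->
  controlled (fun x => F2 x - F1 x) (fun x => v1 x + v2 x).
Proof.
  intros H1 H2 x y Hxy; generalize (H1 x y Hxy) (H2 x y Hxy).
  unfold Rabs; repeat destruct Rcase_abs; lra.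
Qed.

(** * Riemann integrability of products of continuous and controlled functions *)

Lemma ex_RInt_uniform_limit (s : nat -> R -> R) f c d :
  c <= d -> (forall N, ex_RInt (s N) c d) ->
  (forall eps, 0 < eps -> exists N0, forall N, (N0 <= N)%nat ->
     forall x, c <= x <= d -> Rabs (s N x - f x) < eps) ->
  ex_RInt f c d.
Proof.
  intros Hcd Hs Hlim.
  (* [filterlim_RInt] asks for uniform convergence on the whole line; truncating to 0 outside
     [[c, d]] provides it without changing the integrals. *)
  set (cut := fun (g : R -> R) x => if Rle_dec c x then if Rle_dec x d then g x else 0 else 0).
  assert (Hcut : forall g x, c < x < d -> g x = cut g x).
  { intros g x Hx; unfold cut; repeat destruct Rle_dec; lra. }
  destruct (filterlim_RInt (fun N => cut (s N)) c d eventually _ (cut f)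
              (fun N => RInt (s N) c d)) as [If [_ HIf]].
  - intros N; apply is_RInt_ext with (s N).
    + rewrite Rmin_left, Rmax_right by easy; auto.
    + now apply (RInt_correct (s N)).
  - apply filterlim_locally; intros eps.
    destruct (Hlim eps (cond_pos eps)) as [N0 HN0]; exists N0; intros N HN x.
    change (Rabs (cut (s N) x - cut f x) < eps).
    unfold cut; repeat destruct Rle_dec; auto;
      rewrite Rminus_diag, Rabs_R0; apply cond_pos.
  - exists If; apply is_RInt_ext with (cut f); [|easy].
    rewrite Rmin_left, Rmax_right by easy; intros; symmetry; auto.
Qed.

Lemma ex_RInt_continuous_R (u : R -> R) c d :
  (forall x, continuous u x) -> ex_RInt u c d.
Proof. intros Hu; apply (ex_RInt_continuous (V := R_CompleteNormedModule)); auto. Qed.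

(** A superlevel set of a monotone function is a half-line, so the product is 0 before the threshold
    [s] and [u] after it; the value at [s] is immaterial. *)
Lemma ex_RInt_mult_upset (u w : R -> R) l c d :
  c <= d -> (forall x, continuous u x) -> (forall x y, x <= y -> w x <= w y) ->
  ex_RInt (fun x => u x * (if Rle_dec l (w x) then 1 else 0)) c d.
Proof.
  intros Hcd Hu Hw.
  (* The disjunct [x = c] keeps the set nonempty when all of [[c, d]] lies above level [l]. *)
  destruct (completeness (fun x => c <= x <= d /\ (x = c \/ w x < l))) as [s [Hs1 Hs2]].
  { exists d; intros x Hx; lra. }
  { exists c; lra. }
  assert (Hcs : c <= s) by (apply Hs1; lra).
  assert (Hsd : s <= d) by (apply Hs2; intros x Hx; lra).
  apply ex_RInt_Chasles with s.
  - apply ex_RInt_ext with (fun _ => 0); [|apply ex_RInt_const].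
    rewrite Rmin_left, Rmax_right by easy; intros x Hx.
    destruct Rle_dec as [Hl|Hl]; [|lra].
    assert (s <= x); [|lra].
    apply Hs2; intros y [Hy1 Hy2].
    destruct (Rle_dec y x) as [|Hyx]; [easy|].
    generalize (Hw x y); lra.
  - apply ex_RInt_ext with u; [|now apply ex_RInt_continuous_R].
    rewrite Rmin_left, Rmax_right by easy; intros x Hx.
    destruct Rle_dec as [Hl|Hl]; [lra|].
    assert (x <= s); [|lra].
    apply Hs1; lra.
Qed.

(* Layer-cake approximation: [w] is within [eta] of the sum of [eta] times the
   indicators of its superlevel sets, which are up-sets because [w] is monotone. *)
Lemma layer_cake_error (w eta : R) K :
  0 < eta -> 0 <= w ->
  (INR K * eta <= w ->
   sumR K (fun k => eta * (if Rle_dec (INR (S k) * eta) w then 1 else 0)) = INR K * eta) /\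
  (w < INR K * eta ->
   Rabs (sumR K (fun k => eta * (if Rle_dec (INR (S k) * eta) w then 1 else 0)) - w) <= eta).
Proof.
  intros Heta Hw; induction K as [|K [IH1 IH2]].
  { simpl; split; intros; lra. }
  change (sumR (S K) ?g) with (sumR K g + g K); cbv beta.
  assert (HS : INR (S K) * eta = INR K * eta + eta) by (rewrite S_INR; ring).
  rewrite HS; split; intros H.
  - rewrite IH1 by lra; destruct Rle_dec; lra.
  - destruct Rle_dec; [lra|].
    destruct (Rle_dec (INR K * eta) w) as [H'|H'].
    + rewrite IH1 by lra; unfold Rabs; destruct Rcase_abs; lra.
    + rewrite Rmult_0_r, Rplus_0_r; apply IH2; lra.
Qed.

Lemma ex_RInt_mult_sumR (u : R -> R) (g : nat -> R -> R) c d K :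
  (forall k, ex_RInt (fun x => u x * g k x) c d) ->
  ex_RInt (fun x => u x * sumR K (fun k => g k x)) c d.
Proof.
  intros H; induction K as [|K IH].
  - apply ex_RInt_ext with (fun _ => 0); [intros; simpl; lra|apply ex_RInt_const].
  - apply ex_RInt_ext with
      (fun x => plus (u x * sumR K (fun k => g k x)) (u x * g K x)).
    + intros; unfold plus; simpl; ring.
    + now apply (ex_RInt_plus (V := R_NormedModule)).
Qed.

Lemma ex_RInt_mult_monotone (u w : R -> R) c d :
  c <= d -> (forall x, continuous u x) -> (forall x y, x <= y -> w x <= w y) ->
  ex_RInt (fun x => u x * w x) c d.
Proof.
  intros Hcd Hu Hw.
  assert (Hub : exists M, 0 < M /\ forall x, c <= x <= d -> Rabs (u x) <= M).
  { destruct (ex_RInt_ub u c d) as [M HM]; [now apply ex_RInt_continuous_R|].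
    rewrite Rmin_left, Rmax_right in HM by easy.
    exists (Rmax M 1); split; [generalize (Rmax_r M 1); lra|].
    intros x Hx; apply Rle_trans with (2 := Rmax_l M 1); now apply HM. }
  destruct Hub as [M [HM0 HM]].
  (* [Z * S N] levels of height [eta N = / INR (S N)] reach the height [Z], above the whole range of
     [w - w c], whatever [N] is. *)
  destruct (INR_unbounded (w d - w c)) as [Z HZ].
  set (eta := fun N => / INR (S N)).
  assert (Heta : forall N, 0 < eta N).
  { intros N; apply Rinv_0_lt_compat, lt_0_INR; lia. }
  apply ex_RInt_ext with
    (fun x => plus (u x * (w x - w c)) (scal (w c) (u x))).
  { intros x _; unfold plus, scal; simpl; unfold mult; simpl; ring. }
  apply (ex_RInt_plus (V := R_NormedModule)); [|now apply (ex_RInt_scal (V := R_NormedModule)), ex_RInt_continuous_R].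
  apply ex_RInt_uniform_limit with
    (s := fun N x => u x * sumR (Z * S N) (fun k =>
            eta N * (if Rle_dec (INR (S k) * eta N + w c) (w x) then 1 else 0))); [easy| |].
  - intros N; apply ex_RInt_mult_sumR; intros k.
    apply ex_RInt_ext with
      (fun x => scal (eta N) (u x * (if Rle_dec (INR (S k) * eta N + w c) (w x) then 1 else 0))).
    + intros x _; unfold scal; simpl; unfold mult; simpl; ring.
    + now apply (ex_RInt_scal (V := R_NormedModule)), ex_RInt_mult_upset.
  - intros eps Heps.
    destruct (INR_unbounded (M / eps)) as [N0 HN0]; exists N0; intros N HN x Hx.
    rewrite <- Rmult_minus_distr_l, Rabs_mult.
    assert (HxM := HM x Hx).
    assert (H1 : w c <= w x) by (apply Hw; lra).
    assert (H2 : w x <= w d) by (apply Hw; lra).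
    assert (HK : INR (Z * S N) * eta N = INR Z).
    { rewrite mult_INR; unfold eta; field; apply not_0_INR; lia. }
    destruct (layer_cake_error (w x - w c) (eta N) (Z * S N)) as [_ H]; [easy|lra|].
    rewrite HK in H.
    assert (H' := H ltac:(lra)); clear H.
    rewrite (sumR_ext _ _ (fun k => eta N *
      (if Rle_dec (INR (S k) * eta N + w c) (w x) then 1 else 0))) in H'.
    2:{ intros k _; do 2 destruct Rle_dec; lra. }
    apply Rle_lt_trans with (M * eta N).
    + apply Rmult_le_compat; auto using Rabs_pos.
    + unfold eta; apply Rmult_lt_reg_r with (INR (S N)); [apply lt_0_INR; lia|].
      rewrite Rmult_assoc, Rinv_l, Rmult_1_r by (apply not_0_INR; lia).
      assert (INR N0 <= INR (S N)) by (apply le_INR; lia).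
      apply Rmult_lt_reg_r with (/ eps); [now apply Rinv_0_lt_compat|].
      replace (eps * INR (S N) * / eps) with (INR (S N)) by (field; lra).
      unfold Rdiv in HN0; lra.
Qed.

Lemma ex_RInt_mult_controlled (u F v : R -> R) c d :
  (forall x, continuous u x) -> controlled F v -> ex_RInt (fun x => u x * F x) c d.
Proof.
  intros Hu HF.
  assert (H : forall c d, c <= d -> ex_RInt (fun x => u x * F x) c d).
  { clear c d; intros c d Hcd.
    (* Jordan decomposition [F = v - (v - F)] into two nondecreasing functions. *)
    apply ex_RInt_ext with (fun x => minus (u x * v x) (u x * (v x - F x))).
    { intros x _; unfold minus, plus, opp; simpl; ring. }
    apply (ex_RInt_minus (V := R_NormedModule)); apply ex_RInt_mult_monotone; auto.
    - intros x y Hxy; generalize (HF x y Hxy) (Rabs_pos (F y - F x)); lra.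
    - intros x y Hxy; generalize (HF x y Hxy) (Rle_abs (F y - F x)); lra. }
  destruct (Rle_dec c d); [auto|apply ex_RInt_swap, H; lra].
Qed.

(** * Riemann-Stieltjes sums and integration by parts *)

Lemma partition_in a b m p i :
  is_partition a b m p -> (i <= m)%nat -> a <= p i <= b.
Proof.
  intros (H0 & Hm & Hp) Hi; split.
  - rewrite <- H0; clear H0 Hm; induction i as [|i IH]; [lra|].
    generalize (Hp i ltac:(lia)) (IH ltac:(lia)); lra.
  - rewrite <- Hm; clear H0 Hm.
    assert (H : forall k, (i + k <= m)%nat -> p i <= p (i + k)%nat).
    { induction k as [|k IH]; intros Hk; [rewrite Nat.add_0_r; lra|].
      rewrite Nat.add_succ_r; generalize (Hp (i + k)%nat ltac:(lia)) (IH ltac:(lia)); lra. }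
    generalize (H (m - i)%nat ltac:(lia)); now replace (i + (m - i))%nat with m by lia.
Qed.

Definition uniform_node (a b : R) (N : nat) (i : nat) : R :=
  a + INR i * ((b - a) / INR N).

Lemma uniform_node_partition a b N :
  a < b -> (0 < N)%nat -> is_partition a b N (uniform_node a b N).
Proof.
  intros Hab HN; assert (HN' : 0 < INR N) by now apply lt_0_INR.
  unfold uniform_node; repeat split; [simpl; lra|field; lra|].
  intros i _; rewrite S_INR.
  assert (0 < (b - a) / INR N) by (apply Rdiv_lt_0_compat; lra); lra.
Qed.

Lemma uniform_node_step a b N i :
  uniform_node a b N (S i) - uniform_node a b N i = (b - a) / INR N.
Proof. unfold uniform_node; rewrite S_INR; ring. Qed.

Lemma uniform_mesh_small a b delta :
  a < b -> 0 < delta -> exists N, (0 < N)%nat /\ (b - a) / INR N < delta.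
Proof.
  intros Hab Hd; destruct (INR_unbounded ((b - a) / delta)) as [N HN].
  assert (H0 : 0 < (b - a) / delta) by (apply Rdiv_lt_0_compat; lra).
  assert (HN' : 0 < INR N) by lra.
  exists N; split; [now apply INR_lt|].
  apply Rmult_lt_reg_r with (INR N / delta); [now apply Rdiv_lt_0_compat|].
  replace ((b - a) / INR N * (INR N / delta)) with ((b - a) / delta) by (field; lra).
  replace (delta * (INR N / delta)) with (INR N) by (field; lra); easy.
Qed.

Lemma RS_sum_clamp f F a b m p t :
  is_partition a b m p ->
  RS_sum f (fun x => F (clamp a b x)) m p t = RS_sum f F m p t.
Proof.
  intros Hp; apply sumR_ext; intros i Hi.
  rewrite !clamp_id; [easy| |]; apply (partition_in a b m p); auto; lia.
Qed.

Lemma is_RSInt_clamp f F a b I :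
  is_RSInt f (fun x => F (clamp a b x)) a b I <-> is_RSInt f F a b I.
Proof.
  split; intros H eps Heps; destruct (H eps Heps) as (d & Hd & H');
    exists d; split; auto; intros m p t Hp Ht Hmesh.
  - rewrite <- (RS_sum_clamp f F a b) by easy; auto.
  - rewrite (RS_sum_clamp f F a b) by easy; auto.
Qed.

Lemma RS_sum_minus_l f g F m p t :
  RS_sum f F m p t - RS_sum g F m p t = RS_sum (fun x => f x - g x) F m p t.
Proof. unfold RS_sum; rewrite <- sumR_minus; apply sumR_ext; intros; ring. Qed.

Lemma RS_sum_minus_r f F G m p t :
  RS_sum f F m p t - RS_sum f G m p t = RS_sum f (fun x => F x - G x) m p t.
Proof. unfold RS_sum; rewrite <- sumR_minus; apply sumR_ext; intros; ring. Qed.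

Lemma RS_sum_bound f F v a b eps m p t :
  controlled F v -> is_partition a b m p ->
  (forall i, (i < m)%nat -> p i <= t i <= p (S i)) ->
  (forall x, a <= x <= b -> Rabs (f x) <= eps) ->
  Rabs (RS_sum f F m p t) <= eps * (v b - v a).
Proof.
  intros HF Hp Ht Hf.
  assert (Hp' := Hp); destruct Hp' as (H0 & Hm & Hinc).
  rewrite <- H0 at 1; rewrite <- Hm at 1; rewrite <- (sumR_telescope m (fun i => v (p i))).
  rewrite <- sumR_scal; eapply Rle_trans; [apply sumR_abs|].
  apply sumR_le; intros i Hi; rewrite Rabs_mult.
  apply Rmult_le_compat; auto using Rabs_pos.
  - apply Hf; generalize (Ht i Hi).
    generalize (partition_in a b m p i Hp ltac:(lia)) (partition_in a b m p (S i) Hp Hi); lra.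
  - apply HF; left; auto.
Qed.

Lemma RInt_mult_oscillation (k F : R -> R) c M V x y :
  x <= y -> 0 <= M -> ex_RInt k x y -> ex_RInt (fun s => k s * F s) x y ->
  (forall s, x <= s <= y -> Rabs (k s) <= M) ->
  (forall s, x <= s <= y -> Rabs (c - F s) <= V) ->
  Rabs (c * RInt k x y - RInt (fun s => k s * F s) x y) <= (y - x) * (M * V).
Proof.
  intros Hxy HM0 Hk HkF HM HV.
  assert (H : is_RInt (fun s => k s * (c - F s)) x y
                (c * RInt k x y - RInt (fun s => k s * F s) x y)).
  { apply (is_RInt_ext (fun s => minus (scal c (k s)) (k s * F s))).
    { intros s _; unfold minus, scal, plus, opp; simpl; unfold mult; simpl; ring. }
    apply @is_RInt_minus; [apply @is_RInt_scal|]; now apply (RInt_correct (V := R_CompleteNormedModule)). }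
  apply (norm_RInt_le_const _ x y _ (M * V) Hxy) in H; [easy|].
  intros s Hs; change (Rabs (k s * (c - F s)) <= M * V).
  rewrite Rabs_mult; apply Rmult_le_compat; auto using Rabs_pos.
Qed.

Lemma RInt_Chasles_R (f : R -> R) a b c :
  ex_RInt f a b -> ex_RInt f b c -> RInt f a c = RInt f a b + RInt f b c.
Proof. intros H1 H2; symmetry; exact (RInt_Chasles f a b c H1 H2). Qed.

Lemma RInt_derive (g g' : R -> R) x y :
  (forall s, is_derive g s (g' s)) -> (forall s, continuous g' s) ->
  RInt g' x y = g y - g x.
Proof.
  intros Hg Hc; apply is_RInt_unique.
  apply (is_RInt_derive (V := R_CompleteNormedModule)); auto.
Qed.

Lemma continuous_bounded (g : R -> R) a b :
  a <= b -> (forall x, continuous g x) ->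
  exists M, 0 <= M /\ forall x, a <= x <= b -> Rabs (g x) <= M.
Proof.
  intros Hab Hg.
  destruct (ex_RInt_ub g a b) as [M HM]; [now apply ex_RInt_continuous_R|].
  rewrite Rmin_left, Rmax_right in HM by easy.
  exists (Rabs M); split; [apply Rabs_pos|].
  intros x Hx; apply Rle_trans with M; [now apply HM|apply Rle_abs].
Qed.

(** Cutting at the tag [t] writes the defect as two integrals of [g'] against [F x - F] on [[x, t]]
    and [F y - F] on [[t, y]], both differences being at most [v y - v x] in absolute value. *)
Lemma RS_by_parts_local g g' F v M x t y :
  (forall s, is_derive g s (g' s)) -> (forall s, continuous g' s) ->
  controlled F v -> x <= t <= y -> 0 <= M ->
  (forall s, x <= s <= y -> Rabs (g' s) <= M) ->
  Rabs (g t * (F y - F x) - (g y * F y - g x * F x - RInt (fun s => g' s * F s) x y))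
    <= M * (y - x) * (v y - v x).
Proof.
  intros Hg Hc HF Ht HM0 HM.
  assert (Hi : forall c d, ex_RInt (fun s => g' s * F s) c d)
    by (intros; now apply ex_RInt_mult_controlled with v).
  rewrite (RInt_Chasles_R _ x t y) by auto.
  assert (Hmono : forall c d, c <= d -> v c <= v d).
  { intros c d Hcd; generalize (HF c d Hcd) (Rabs_pos (F d - F c)); lra. }
  assert (H1 : Rabs (F x * RInt g' x t - RInt (fun s => g' s * F s) x t)
               <= (t - x) * (M * (v y - v x))).
  { apply RInt_mult_oscillation; auto; try lra.
    - now apply ex_RInt_continuous_R.
    - intros; apply HM; lra.
    - intros s Hs; rewrite Rabs_minus_sym.
      generalize (HF x s ltac:(lra)) (Hmono s y ltac:(lra)); lra. }
  assert (H2 : Rabs (F y * RInt g' t y - RInt (fun s => g' s * F s) t y)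
               <= (y - t) * (M * (v y - v x))).
  { apply RInt_mult_oscillation; auto; try lra.
    - now apply ex_RInt_continuous_R.
    - intros; apply HM; lra.
    - intros s Hs.
      generalize (HF s y ltac:(lra)) (Hmono x s ltac:(lra)); lra. }
  rewrite !(RInt_derive g g') in * by auto.
  replace (g t * (F y - F x) - _) with
    (- ((F x * (g t - g x) - RInt (fun s => g' s * F s) x t) +
        (F y * (g y - g t) - RInt (fun s => g' s * F s) t y))) by ring.
  rewrite Rabs_Ropp; eapply Rle_trans; [apply Rabs_triang|].
  replace (M * (y - x) * (v y - v x)) with
    ((t - x) * (M * (v y - v x)) + (y - t) * (M * (v y - v x))) by ring.
  lra.
Qed.

Lemma is_RSInt_C1 g g' F v a b :
  a < b -> (forall s, is_derive g s (g' s)) -> (forall s, continuous g' s) ->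
  controlled F v ->
  is_RSInt g F a b (g b * F b - g a * F a - RInt (fun s => g' s * F s) a b).
Proof.
  intros Hab Hg Hc HF eps Heps.
  destruct (continuous_bounded g' a b) as [M [HM0 HM]]; [lra|easy|].
  assert (HV0 : 0 <= v b - v a).
  { generalize (HF a b ltac:(lra)) (Rabs_pos (F b - F a)); lra. }
  (* The summand 1 keeps [D] positive when [g'] or the variation vanishes, and makes the final bound
     strict. *)
  set (D := M * (v b - v a) + 1).
  assert (HD : 0 < D) by (unfold D; generalize (Rmult_le_pos _ _ HM0 HV0); lra).
  exists (eps / D); split; [now apply Rdiv_lt_0_compat|].
  intros m p t Hp Ht Hmesh.
  (* The claimed value is the increment of [Phi] from [a] to [b], so it splits along any partition
     into the local values estimated above. *)
  set (Phi := fun x => g x * F x - RInt (fun s => g' s * F s) a x).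
  assert (Hi : forall c d, ex_RInt (fun s => g' s * F s) c d)
    by (intros; now apply ex_RInt_mult_controlled with v).
  assert (Hp' := Hp); destruct Hp' as (H0 & Hm & Hinc).
  replace (g b * F b - g a * F a - RInt (fun s => g' s * F s) a b)
    with (sumR m (fun i => Phi (p (S i)) - Phi (p i))).
  2:{ rewrite (sumR_telescope m (fun i => Phi (p i))), H0, Hm; unfold Phi.
      rewrite (RInt_point (V := R_CompleteNormedModule)); unfold zero; simpl; ring. }
  unfold RS_sum; rewrite <- sumR_minus.
  apply Rle_lt_trans with (sumR m (fun i => M * (eps / D) * (v (p (S i)) - v (p i)))).
  - eapply Rle_trans; [apply sumR_abs|].
    apply sumR_le; intros i Hi'.
    assert (Hpi := partition_in a b m p i Hp ltac:(lia)).
    assert (Hpi' := partition_in a b m p (S i) Hp Hi').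
    assert (Hlt := Hinc i Hi'); assert (Hms := Hmesh i Hi').
    unfold Phi; rewrite (RInt_Chasles_R _ a (p i) (p (S i))) by auto.
    replace (g (p (S i)) * F (p (S i)) - _ - _) with
      (g (p (S i)) * F (p (S i)) - g (p i) * F (p i)
       - RInt (fun s => g' s * F s) (p i) (p (S i))) by ring.
    eapply Rle_trans.
    { apply (RS_by_parts_local g g' F v M); auto; intros; apply HM; lra. }
    apply Rmult_le_compat_r.
    + generalize (HF (p i) (p (S i)) ltac:(lra)) (Rabs_pos (F (p (S i)) - F (p i))); lra.
    + apply Rmult_le_compat_l; lra.
  - rewrite sumR_scal, (sumR_telescope m (fun i => v (p i))), H0, Hm.
    replace (M * (eps / D) * (v b - v a)) with (eps * ((D - 1) / D)) by (unfold D; field; fold D; lra).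
    rewrite <- (Rmult_1_r eps) at 2; apply Rmult_lt_compat_l; [easy|].
    apply Rmult_lt_reg_r with D; [easy|]; unfold Rdiv; rewrite Rmult_assoc, Rinv_l; lra.
Qed.

(** * Integration by parts against iterated primitives *)

Lemma quadratic_increments_const h C a b :
  a < b -> (forall x y, a <= x -> x <= y -> y <= b -> Rabs (h y - h x) <= C * (y - x) ^ 2) ->
  h b = h a.
Proof.
  intros Hab H.
  assert (HC : 0 <= C * (b - a) ^ 2).
  { generalize (H a b ltac:(lra) ltac:(lra) ltac:(lra)) (Rabs_pos (h b - h a)); lra. }
  enough (Hle : Rabs (h b - h a) <= 0).
  { generalize (Rabs_pos (h b - h a)); intros.
    assert (h b - h a = 0); [|lra].
    destruct (Req_dec (h b - h a) 0) as [|Hn]; [easy|].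
    apply Rabs_no_R0 in Hn; lra. }
  apply le_epsilon; intros eps Heps; rewrite Rplus_0_l.
  (* Over [N] equal cells the quadratic bounds add up to [C * (b - a) ^ 2 / N], which this choice
     brings below [eps]. *)
  destruct (INR_unbounded (C * (b - a) ^ 2 / eps)) as [N HN].
  assert (H0 : 0 <= C * (b - a) ^ 2 / eps) by (apply Rle_div_r; lra).
  assert (HN' : 0 < INR N) by lra.
  assert (Hp := uniform_node_partition a b N Hab (INR_lt 0 N HN')).
  set (p := uniform_node a b N) in *.
  assert (Hp' := Hp); destruct Hp' as (Hp0 & Hpm & Hinc).
  rewrite <- Hpm at 1; rewrite <- Hp0 at 1.
  rewrite <- (sumR_telescope N (fun i => h (p i))).
  eapply Rle_trans; [apply sumR_abs|].
  apply Rle_trans with (sumR N (fun i => C * (b - a) / INR N * (p (S i) - p i))).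
  - apply sumR_le; intros i Hi.
    eapply Rle_trans; [apply H|].
    + apply (partition_in a b N p i Hp); lia.
    + left; auto.
    + apply (partition_in a b N p (S i) Hp); lia.
    + unfold p; rewrite uniform_node_step; right; field; lra.
  - rewrite sumR_scal, (sumR_telescope N p), Hp0, Hpm.
    apply Rmult_le_reg_r with (INR N / eps); [now apply Rdiv_lt_0_compat|].
    replace (C * (b - a) / INR N * (b - a) * (INR N / eps)) with (C * (b - a) ^ 2 / eps)
      by (field; lra).
    replace (eps * (INR N / eps)) with (INR N) by (field; lra); lra.
Qed.

(** The regularity that survives the induction on [J]: it covers the discontinuous [J 0 G a = G] as
    well as the later, continuous primitives. *)
Definition integrable_mult (G : R -> R) : Prop :=
  forall u : R -> R, (forall x, continuous u x) ->
  forall c d, ex_RInt (fun x => u x * G x) c d.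

Lemma integrable_mult_ex_RInt G c d : integrable_mult G -> ex_RInt G c d.
Proof.
  intros HG; apply ex_RInt_ext with (fun x => 1 * G x); [intros; apply Rmult_1_l|].
  apply HG; intros; apply continuous_const.
Qed.

Lemma integrable_mult_continuous G : (forall x, continuous G x) -> integrable_mult G.
Proof.
  intros HG u Hu c d; apply ex_RInt_continuous_R; intros x.
  now apply (continuous_mult u G).
Qed.

Lemma continuous_primitive (G : R -> R) a x :
  (forall c d, ex_RInt G c d) -> continuous (fun y => RInt G a y) x.
Proof.
  intros HG; apply (continuous_RInt_1 G a x (fun y => RInt G a y)).
  apply filter_forall; intros y; now apply (RInt_correct (V := R_CompleteNormedModule)).
Qed.

(** The defect [h] of the identity has quadratic increments, because [g] and the primitive of [G]
    are both Lipschitz on [[a, b]]; hence it is constant, and no derivative of the primitive is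
    taken. *)
Lemma RInt_by_parts_primitive g g' G a b :
  a < b -> (forall s, is_derive g s (g' s)) -> (forall s, continuous g' s) ->
  integrable_mult G ->
  RInt (fun s => g s * G s) a b
  = g b * RInt G a b - RInt (fun s => g' s * RInt G a s) a b.
Proof.
  intros Hab Hg Hc HG.
  set (J := fun x => RInt G a x).
  assert (HGi : forall c d, ex_RInt G c d) by (intros; now apply integrable_mult_ex_RInt).
  assert (HJ : forall x, continuous J x) by (intros; now apply continuous_primitive).
  assert (Hgc : forall x, continuous g x).
  { intros x; apply (ex_derive_continuous g); eexists; apply Hg. }
  assert (Hi1 : forall c d, ex_RInt (fun s => g s * G s) c d) by (intros; now apply HG).
  assert (Hi2 : forall c d, ex_RInt (fun s => g' s * J s) c d)
    by (intros; now apply integrable_mult_continuous).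
  destruct (ex_RInt_ub G a b (HGi a b)) as [K0 HK0].
  rewrite Rmin_left, Rmax_right in HK0 by lra.
  assert (HK : forall s, a <= s <= b -> Rabs (G s) <= Rabs K0).
  { intros s Hs; apply Rle_trans with K0; [now apply HK0|apply Rle_abs]. }
  clear HK0; set (K := Rabs K0) in *.
  assert (HK0 : 0 <= K) by apply Rabs_pos.
  destruct (continuous_bounded g' a b) as [M [HM0 HM]]; [lra|easy|].
  set (h := fun x => g x * J x - RInt (fun s => g' s * J s) a x
                     - RInt (fun s => g s * G s) a x).
  enough (Hh : h b = h a).
  { unfold h, J in Hh; rewrite !(RInt_point (V := R_CompleteNormedModule)) in Hh.
    unfold zero in Hh; simpl in Hh; unfold J; lra. }
  apply quadratic_increments_const with (2 * (M * K)); [easy|].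
  intros x y Hx Hxy Hy.
  assert (HJ' : forall s y, a <= s -> s <= y -> y <= b -> Rabs (J y - J s) <= K * (y - s)).
  { clear x y Hx Hxy Hy; intros s y Hs Hsy Hy; unfold J; rewrite (RInt_Chasles_R G a s y) by auto.
    rewrite Rplus_minus_l.
    rewrite Rmult_comm; apply abs_RInt_le_const; auto; intros; apply HK; lra. }
  assert (Hg' : forall x s, a <= x -> x <= s -> s <= b -> Rabs (g x - g s) <= M * (s - x)).
  { clear x y Hx Hxy Hy; intros x s Hx Hxs Hs; rewrite Rabs_minus_sym.
    rewrite <- (RInt_derive g g') by auto.
    rewrite Rmult_comm; apply abs_RInt_le_const; auto;
      [now apply ex_RInt_continuous_R|intros; apply HM; lra]. }
  assert (H1 : Rabs (J y * RInt g' x y - RInt (fun s => g' s * J s) x y)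
               <= (y - x) * (M * (K * (y - x)))).
  { apply RInt_mult_oscillation; auto.
    - now apply ex_RInt_continuous_R.
    - intros; apply HM; lra.
    - intros s Hs; eapply Rle_trans; [apply HJ'; lra|].
      apply Rmult_le_compat_l; lra. }
  assert (H2 : Rabs (g x * RInt G x y - RInt (fun s => G s * g s) x y)
               <= (y - x) * (K * (M * (y - x)))).
  { apply RInt_mult_oscillation; auto.
    - apply ex_RInt_ext with (fun s => g s * G s); auto; intros; apply Rmult_comm.
    - intros; apply HK; lra.
    - intros s Hs; eapply Rle_trans; [apply Hg'; lra|].
      apply Rmult_le_compat_l; lra. }
  rewrite (RInt_ext (fun s => G s * g s) (fun s => g s * G s)) in H2
    by (intros; apply Rmult_comm).
  rewrite (RInt_derive g g') in H1 by auto.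
  unfold h, J in *.
  rewrite (RInt_Chasles_R _ a x y (Hi1 a x) (Hi1 x y)),
          (RInt_Chasles_R _ a x y (Hi2 a x) (Hi2 x y)).
  rewrite (RInt_Chasles_R G a x y) in * by auto.
  (* The increment of [h], with the primitive frozen at [y] in the first bracket and [g] frozen at
     [x] in the second. *)
  match goal with |- Rabs ?e <= _ => replace e with
    (((RInt G a x + RInt G x y) * (g y - g x) - RInt (fun s => g' s * RInt G a s) x y) +
     (g x * RInt G x y - RInt (fun s => g s * G s) x y)) by ring end.
  eapply Rle_trans; [apply Rabs_triang|].
  eapply Rle_trans; [apply Rplus_le_compat; eassumption|right; ring].
Qed.

Lemma integrable_mult_J G a k :
  integrable_mult G -> integrable_mult (J k G a) /\
  ((1 <= k)%nat -> forall x, continuous (J k G a) x).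
Proof.
  intros HG; induction k as [|k [IH _]]; [split; [easy|lia]|].
  assert (Hc : forall x, continuous (J (S k) G a) x).
  { intros x; apply continuous_primitive; intros; now apply integrable_mult_ex_RInt. }
  split; [now apply integrable_mult_continuous|auto].
Qed.

(** The left side is the integral of [g 0] against [dG] when [G a = 0]. Boundary terms are assumed
    to vanish as products: for the test functions the factor [g k b] is zero, in the sufficiency
    part the factor [J k G a b]. *)
Lemma iterated_by_parts (g : nat -> R -> R) G a b n :
  a < b -> integrable_mult G ->
  (forall k x, (k <= n)%nat -> is_derive (g k) x (g (S k) x)) ->
  (forall x, continuous (g (S n)) x) ->
  (forall k, (k < n)%nat -> g k b * J k G a b = 0) ->
  g O b * G b - RInt (fun s => g 1%nat s * G s) a b
  = (-1) ^ n * (g n b * J n G a b - RInt (fun s => g (S n) s * J n G a s) a b).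
Proof.
  intros Hab HG; induction n as [|n IH]; intros Hg Hc Hb; [simpl; ring|].
  assert (Hc' : forall x, continuous (g (S n)) x).
  { intros x; apply (ex_derive_continuous (g (S n))); eexists; apply Hg; lia. }
  rewrite IH; auto with arith.
  rewrite Hb by lia.
  rewrite (RInt_by_parts_primitive (g (S n)) (g (S (S n))) (J n G a) a b); auto with arith.
  - change (RInt (J n G a) a b) with (J (S n) G a b).
    change (fun s => g (S (S n)) s * RInt (J n G a) a s)
      with (fun s => g (S (S n)) s * J (S n) G a s).
    simpl pow; ring.
  - now apply integrable_mult_J.
Qed.

(** * Divided differences and derivatives *)

Lemma prodR_eq_0 m g i : (i < m)%nat -> g i = 0 -> prodR m g = 0.
Proof.
  induction m as [|m IH]; simpl; intros Hi Hg; [lia|].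
  destruct (Nat.eq_dec i m) as [<-|Hn]; [rewrite Hg; ring|].
  rewrite IH; [ring|lia|easy].
Qed.

Lemma prodR_neq_0 m g : (forall i, (i < m)%nat -> g i <> 0) -> prodR m g <> 0.
Proof.
  induction m as [|m IH]; simpl; intros H; [lra|].
  apply Rmult_integral_contrapositive; auto with arith.
Qed.

Lemma sumR_single m g k :
  (k < m)%nat -> (forall i, (i < m)%nat -> i <> k -> g i = 0) -> sumR m g = g k.
Proof.
  induction m as [|m IH]; simpl; intros Hk H; [lia|].
  destruct (Nat.eq_dec k m) as [->|Hn].
  - rewrite (sumR_ext m g (fun _ => 0 * 0)).
    + rewrite sumR_scal; ring.
    + intros i Hi; rewrite H by lia; ring.
  - rewrite IH by (intros; try apply H; lia).
    rewrite (H m) by lia; ring.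
Qed.

(** Describes a polynomial of degree at most [m] whose coefficient of degree [m] is [K / m!],
    through its chain of derivatives, the only data that Rolle's theorem consumes. *)
Definition const_derivative (m : nat) (P : R -> R) (K : R) : Prop :=
  exists g : nat -> R -> R,
    (forall x, g O x = P x) /\
    (forall k x, is_derive (g k) x (g (S k) x)) /\
    (forall x, g m x = K).

Lemma is_derive_constant (g : R -> R) K x l :
  (forall y, g y = K) -> is_derive g x l -> l = 0.
Proof.
  intros Hg Hd; apply is_derive_unique in Hd; rewrite <- Hd.
  apply is_derive_unique, is_derive_ext with (fun _ => K); [easy|].
  apply @is_derive_const.
Qed.

Lemma const_derivative_ext m P Q K L :
  (forall x, P x = Q x) -> K = L -> const_derivative m P K -> const_derivative m Q L.
Proof.
  intros HPQ <- (g & H0 & Hd & Hm); exists g; split; [|easy].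
  intros; now rewrite H0.
Qed.

Lemma const_derivative_plus m P Q K L :
  const_derivative m P K -> const_derivative m Q L ->
  const_derivative m (fun x => P x + Q x) (K + L).
Proof.
  intros (g & Hg0 & Hgd & Hgm) (h & Hh0 & Hhd & Hhm).
  exists (fun k x => g k x + h k x); split; [|split].
  - intros; now rewrite Hg0, Hh0.
  - intros k x; now apply @is_derive_plus.
  - intros; now rewrite Hgm, Hhm.
Qed.

Lemma const_derivative_scal m P K c :
  const_derivative m P K -> const_derivative m (fun x => c * P x) (c * K).
Proof.
  intros (g & Hg0 & Hgd & Hgm).
  exists (fun k x => c * g k x); split; [|split].
  - intros; now rewrite Hg0.
  - intros k x; now apply is_derive_scal.
  - intros; now rewrite Hgm.
Qed.

Lemma const_derivative_0 m : const_derivative m (fun _ => 0) 0.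
Proof. exists (fun _ _ => 0); split; [easy|split; [|easy]]; intros; apply @is_derive_const. Qed.

Lemma const_derivative_sumR m N (P : nat -> R -> R) (K : nat -> R) :
  (forall i, (i < N)%nat -> const_derivative m (P i) (K i)) ->
  const_derivative m (fun x => sumR N (fun i => P i x)) (sumR N K).
Proof.
  induction N as [|N IH]; simpl; intros H; [apply const_derivative_0|].
  apply const_derivative_plus; auto.
Qed.

Lemma const_derivative_mult_linear m P K y :
  const_derivative m P K ->
  const_derivative (S m) (fun x => P x * (x - y)) (INR (S m) * K).
Proof.
  intros (g & Hg0 & Hgd & Hgm).
  (* Leibniz' rule with a linear factor; at [k = 0] the meaningless [pred k] is multiplied by 0. *)
  exists (fun k x => (x - y) * g k x + INR k * g (pred k) x); split; [|split].
  - intros x; rewrite Hg0; simpl; ring.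
  - intros k x.
    assert (H1 : is_derive (fun x => (x - y) * g k x) x (1 * g k x + (x - y) * g (S k) x)).
    { apply (is_derive_mult (fun x => x - y) (g k) x 1 (g (S k) x)); [|easy|intros; apply Rmult_comm].
      auto_derive; [easy|ring]. }
    assert (H2 : is_derive (fun x => INR k * g (pred k) x) x (INR k * g k x)).
    { destruct k as [|k]; [|now apply is_derive_scal].
      apply is_derive_ext with (fun _ => 0); [intros; simpl; ring|].
      replace (INR 0 * g 0%nat x) with 0 by (simpl; ring); apply @is_derive_const. }
    rewrite S_INR; simpl pred.
    replace (_ + _) with ((1 * g k x + (x - y) * g (S k) x) + INR k * g k x) by ring.
    now apply (is_derive_plus (V := R_NormedModule)).
  - intros x; simpl pred; rewrite Hgm.
    rewrite (is_derive_constant (g m) K x (g (S m) x)); auto; ring.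
Qed.

(** The product is monic; its degree is the number of indices below [k] other than [i], whence the
    case distinction. *)
Lemma const_derivative_node_product (x : nat -> R) i k :
  const_derivative (if Nat.leb k i then k else pred k)
    (fun t => prodR k (fun j => if Nat.eqb j i then 1 else t - x j))
    (INR (fact (if Nat.leb k i then k else pred k))).
Proof.
  induction k as [|k IH].
  - exists (fun k _ => match k with O => 1 | _ => 0 end); split; [easy|split; [|easy]].
    intros [|k] t; apply @is_derive_const.
  - simpl prodR; destruct (Nat.eqb k i) eqn:E.
    + apply Nat.eqb_eq in E; subst k.
      rewrite Nat.leb_refl in IH; rewrite (proj2 (Nat.leb_gt (S i) i)) by lia.
      revert IH; apply const_derivative_ext; [intros; ring|easy].
    + apply Nat.eqb_neq in E.
      assert (H : (if Nat.leb (S k) i then S k else pred (S k))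
                  = S (if Nat.leb k i then k else pred k)).
      { destruct (Nat.leb_spec (S k) i), (Nat.leb_spec k i); lia. }
      rewrite H, fact_simpl, mult_INR.
      now apply const_derivative_mult_linear.
Qed.

Lemma strictly_increasing_lt (x : nat -> R) m i j :
  (forall i, (i < m)%nat -> x i < x (S i)) -> (i < j)%nat -> (j <= m)%nat -> x i < x j.
Proof.
  intros H Hij Hj; induction j as [|j IH]; [lia|].
  destruct (Nat.eq_dec i j) as [->|Hn]; [apply H; lia|].
  apply Rlt_trans with (x j); [apply IH; lia|apply H; lia].
Qed.

(* The leading coefficient of the Lagrange interpolant is the divided difference. *)
Lemma interpolating_polynomial f (x : nat -> R) m :
  (forall i, (i < m)%nat -> x i < x (S i)) ->
  exists P, const_derivative m P (INR (fact m) * divdiff f x m) /\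
            forall k, (k <= m)%nat -> P (x k) = f (x k).
Proof.
  intros Hx.
  set (W := fun i t => prodR (S m) (fun j => if Nat.eqb j i then 1 else t - x j)).
  exists (fun t => sumR (S m) (fun i => f (x i) / W i (x i) * W i t)); split.
  - unfold divdiff; rewrite <- sumR_scal.
    assert (H : forall i, (i < S m)%nat ->
      const_derivative m (fun t => f (x i) / W i (x i) * W i t)
        (f (x i) / W i (x i) * INR (fact m))).
    { intros i Hi; apply const_derivative_scal.
      assert (H := const_derivative_node_product x i (S m)).
      rewrite (proj2 (Nat.leb_gt (S m) i)) in H by lia; exact H. }
    apply const_derivative_sumR in H; revert H.
    apply const_derivative_ext; [easy|].
    apply sumR_ext; intros; apply Rmult_comm.
  - intros k Hk; rewrite (sumR_single _ _ k); [|lia|].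
    + field; apply prodR_neq_0; intros j Hj.
      destruct (Nat.eqb j k) eqn:E; [lra|]; apply Nat.eqb_neq in E.
      destruct (Nat.lt_trichotomy j k) as [H|[H|H]]; [|easy|].
      * generalize (strictly_increasing_lt x m j k Hx H ltac:(lia)); lra.
      * generalize (strictly_increasing_lt x m k j Hx H ltac:(lia)); lra.
    + intros i Hi Hik; unfold W at 2.
      rewrite (prodR_eq_0 _ _ k); [ring|lia|].
      rewrite (proj2 (Nat.eqb_neq k i)) by lia; ring.
Qed.

Lemma finite_choice (Q : nat -> R -> Prop) m :
  (forall i, (i < m)%nat -> exists y, Q i y) ->
  exists ys : nat -> R, forall i, (i < m)%nat -> Q i (ys i).
Proof.
  induction m as [|m IH]; intros H; [exists (fun _ => 0); lia|].
  destruct IH as [ys Hys]; [auto with arith|].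
  destruct (H m) as [y Hy]; [lia|].
  exists (fun i => if Nat.eqb i m then y else ys i); intros i Hi.
  destruct (Nat.eqb i m) eqn:E.
  - apply Nat.eqb_eq in E; now subst.
  - apply Nat.eqb_neq in E; apply Hys; lia.
Qed.

(** Rolle's theorem puts a zero of [g 1] in each gap; these [m] zeros are again increasing, and the
    induction runs on the shifted chain. *)
Lemma generalized_Rolle m : forall (g : nat -> R -> R) (x : nat -> R),
  (forall k t, (k < m)%nat -> is_derive (g k) t (g (S k) t)) ->
  (forall i, (i < m)%nat -> x i < x (S i)) ->
  (forall i, (i <= m)%nat -> g O (x i) = 0) ->
  exists xi, x O <= xi <= x m /\ g m xi = 0.
Proof.
  induction m as [|m IH]; intros g x Hg Hx H0.
  { exists (x O); split; [lra|apply H0; lia]. }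
  destruct (finite_choice (fun i y => x i < y < x (S i) /\ g 1%nat y = 0) (S m)) as [y Hy].
  { intros i Hi.
    destruct (MVT_cor2 (g O) (g 1%nat) (x i) (x (S i))) as (c & Hc & Hc').
    - now apply Hx.
    - intros c _; apply is_derive_Reals, Hg; lia.
    - exists c; split; [easy|].
      rewrite !H0 in Hc by lia; assert (Hlt := Hx i Hi).
      assert (Hz : g 1%nat c * (x (S i) - x i) = 0) by lra.
      apply Rmult_integral in Hz; lra. }
  destruct (IH (fun k => g (S k)) y) as (xi & Hxi & Hz).
  - intros; apply Hg; lia.
  - intros i Hi; generalize (Hy i ltac:(lia)) (Hy (S i) ltac:(lia)); lra.
  - intros i Hi; apply Hy; lia.
  - exists xi; split; [|easy].
    generalize (Hy O ltac:(lia)) (Hy m ltac:(lia)); lra.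
Qed.

(** Generalized Rolle applied to [g 0] minus its interpolating polynomial, whose derivative of order
    [m] is constant. *)
Lemma divdiff_mean_value (g : nat -> R -> R) (x : nat -> R) m :
  (forall k t, (k < m)%nat -> is_derive (g k) t (g (S k) t)) ->
  (forall i, (i < m)%nat -> x i < x (S i)) ->
  exists xi, x O <= xi <= x m /\ g m xi = INR (fact m) * divdiff (g O) x m.
Proof.
  intros Hg Hx.
  destruct (interpolating_polynomial (g O) x m Hx) as (P & (p & Hp0 & Hpd & Hpm) & HP).
  destruct (generalized_Rolle m (fun k t => g k t - p k t) x) as (xi & Hxi & Hz).
  - intros k t Hk; apply (is_derive_minus (V := R_NormedModule)); auto.
  - easy.
  - intros i Hi; rewrite Hp0, HP by easy; ring.
  - exists xi; split; [easy|]; rewrite <- (Hpm xi); lra.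
Qed.

Lemma n_convex_of_derivative (g : nat -> R -> R) a b n :
  (forall k t, (k <= n)%nat -> is_derive (g k) t (g (S k) t)) ->
  (forall t, a <= t <= b -> 0 <= g (S n) t) ->
  n_convex n (g O) a b.
Proof.
  intros Hg Hpos x Hx Ha Hb.
  destruct (divdiff_mean_value g x (S n)) as (xi & Hxi & Heq); auto with arith.
  assert (H := Hpos xi ltac:(lra)); rewrite Heq in H.
  apply Rmult_le_reg_l with (INR (fact (S n))); [apply INR_fact_lt_0|lra].
Qed.

(** * Forward differences at equispaced nodes *)

Fixpoint fdiff (m : nat) (c : nat -> R) : nat -> R :=
  match m with
  | O => c
  | S m' => fdiff m' (fun k => c (S k) - c k)
  end.

Lemma fdiff_ext m c d j :
  (forall k, (k <= m)%nat -> c (j + k)%nat = d (j + k)%nat) -> fdiff m c j = fdiff m d j.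
Proof.
  revert c d; induction m as [|m IH]; simpl; intros c d H.
  - generalize (H O ltac:(lia)); now rewrite Nat.add_0_r.
  - apply IH; intros k Hk; rewrite <- Nat.add_succ_r, !H by lia; easy.
Qed.

Lemma fdiff_S m c j : fdiff (S m) c j = fdiff m c (S j) - fdiff m c j.
Proof.
  revert c; induction m as [|m IH]; intros c; [easy|].
  change (fdiff (S (S m)) c j) with (fdiff (S m) (fun k => c (S k) - c k) j).
  now rewrite IH.
Qed.

Lemma fdiff_shift m c i j : fdiff m c (i + j) = fdiff m (fun k => c (i + k)%nat) j.
Proof.
  revert c; induction m as [|m IH]; intros c; [easy|].
  simpl; rewrite IH; apply fdiff_ext; intros k _; now rewrite Nat.add_succ_r.
Qed.

Lemma fdiff_const_derivative m : forall P K x0 h j,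
  const_derivative m P K -> fdiff m (fun k => P (x0 + INR k * h)) j = h ^ m * K.
Proof.
  induction m as [|m IH]; intros P K x0 h j (g & H0 & Hd & Hm).
  { simpl; rewrite <- H0, Hm; ring. }
  set (Q := fun t => P (t + h) - P t).
  cbn [fdiff]; rewrite (fdiff_ext _ _ (fun k => Q (x0 + INR k * h))).
  2:{ intros k _; unfold Q; rewrite S_INR; do 2 f_equal; ring. }
  rewrite (IH Q (h * K)); [simpl; ring|].
  (* One difference lowers the order by one: integrating the constant [K] over [[t, t + h]] leaves
     the constant [h * K]. *)
  exists (fun k t => g k (t + h) - g k t); split; [|split].
  - intros; unfold Q; now rewrite !H0.
  - intros k t; apply (is_derive_minus (V := R_NormedModule)); [|easy].
    replace (g (S k) (t + h)) with (1 * g (S k) (t + h)) by ring.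
    apply (is_derive_comp (V := R_NormedModule) (g k) (fun t => t + h)); [easy|].
    auto_derive; [easy|ring].
  - intros t.
    rewrite <- (RInt_derive (g m) (g (S m))).
    + rewrite (RInt_ext _ (fun _ => K)) by (intros; apply Hm).
      rewrite RInt_const; unfold scal; simpl; unfold mult; simpl; ring.
    + intros; apply Hd.
    + intros s; apply (continuous_ext (fun _ => K)); [easy|apply continuous_const].
Qed.

(** At the nodes [f] may be replaced by its interpolating polynomial, so the forward difference is
    [h ^ (n + 1) * (n + 1)!] times the divided difference. *)
Lemma n_convex_fdiff n f a b x0 h :
  n_convex n f a b -> 0 < h -> a <= x0 -> x0 + INR (S n) * h <= b ->
  0 <= fdiff (S n) (fun k => f (x0 + INR k * h)) O.
Proof.
  intros Hf Hh Ha Hb.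
  assert (Hx : forall i, (i < S n)%nat -> x0 + INR i * h < x0 + INR (S i) * h).
  { intros i _; rewrite S_INR; lra. }
  destruct (interpolating_polynomial f (fun i => x0 + INR i * h) (S n) Hx) as (P & HPd & HP).
  rewrite (fdiff_ext _ _ (fun k => P (x0 + INR k * h))).
  2:{ intros k Hk; symmetry; now apply HP. }
  rewrite (fdiff_const_derivative _ P _ x0 h O HPd).
  apply Rmult_le_pos; [apply pow_le; lra|].
  apply Rmult_le_pos; [apply pos_INR|].
  apply Hf; auto; simpl INR at 1; lra.
Qed.

(** * Bernstein approximation *)

(* De Casteljau's recursion for the Bernstein polynomial with coefficients [c]. *)
Fixpoint bern (N : nat) (c : nat -> R) (t : R) : R :=
  match N with
  | O => c O
  | S N' => (1 - t) * bern N' c t + t * bern N' (fun k => c (S k)) t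
  end.

Lemma bern_ext N t : forall c d,
  (forall k, (k <= N)%nat -> c k = d k) -> bern N c t = bern N d t.
Proof.
  induction N as [|N IH]; simpl; intros c d H; [apply H; lia|].
  rewrite (IH c d), (IH (fun k => c (S k)) (fun k => d (S k))); auto with arith.
Qed.

Lemma bern_plus N t : forall c d,
  bern N (fun k => c k + d k) t = bern N c t + bern N d t.
Proof. induction N as [|N IH]; simpl; intros c d; [easy|]; rewrite !IH; ring. Qed.

Lemma bern_scal N t u : forall c, bern N (fun k => u * c k) t = u * bern N c t.
Proof. induction N as [|N IH]; simpl; intros c; [easy|]; rewrite !IH; ring. Qed.

Lemma bern_minus N t c d :
  bern N (fun k => c k - d k) t = bern N c t - bern N d t.
Proof.
  rewrite (bern_ext _ _ _ (fun k => c k + (-1) * d k)) by (intros; ring).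
  rewrite bern_plus, bern_scal; ring.
Qed.

Lemma bern_const N t u : bern N (fun _ => u) t = u.
Proof. induction N as [|N IH]; simpl; [easy|]; rewrite IH; ring. Qed.

Lemma bern_le N t : 0 <= t <= 1 -> forall c d,
  (forall k, (k <= N)%nat -> c k <= d k) -> bern N c t <= bern N d t.
Proof.
  intros Ht; induction N as [|N IH]; simpl; intros c d H; [apply H; lia|].
  apply Rplus_le_compat; apply Rmult_le_compat_l; try lra; apply IH; auto with arith.
Qed.

Lemma bern_abs_le N t c d :
  0 <= t <= 1 -> (forall k, (k <= N)%nat -> Rabs (c k) <= d k) ->
  Rabs (bern N c t) <= bern N d t.
Proof.
  intros Ht H; apply Rabs_le; split.
  - apply Ropp_le_cancel; rewrite Ropp_involutive.
    replace (- bern N c t) with (-1 * bern N c t) by ring; rewrite <- bern_scal.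
    apply bern_le; auto; intros k Hk; generalize (H k Hk); unfold Rabs; destruct Rcase_abs; lra.
  - apply bern_le; auto; intros k Hk; generalize (H k Hk) (Rle_abs (c k)); lra.
Qed.

Lemma bern_INR N t : bern N INR t = INR N * t.
Proof.
  induction N as [|N IH]; [simpl; ring|].
  cbn [bern]; rewrite (bern_ext _ _ (fun k => INR (S k)) (fun k => INR k + 1))
    by (intros; apply S_INR).
  rewrite bern_plus, bern_const, IH, S_INR; ring.
Qed.

Lemma bern_INR_sqr N t :
  bern N (fun k => INR k * INR k) t = INR N * t * (1 - t) + INR N * INR N * t * t.
Proof.
  induction N as [|N IH]; [simpl; ring|].
  cbn [bern].
  rewrite (bern_ext _ _ (fun k => INR (S k) * INR (S k))
                        (fun k => INR k * INR k + (2 * INR k + 1)))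
    by (intros; rewrite S_INR; ring).
  rewrite !bern_plus, bern_scal, bern_const, IH, bern_INR, S_INR; ring.
Qed.

(** Variance of [k / N] for [k] binomial with parameters [N] and [t]; its decay like [1 / N] drives
    the uniform convergence. *)
Lemma bern_variance N t :
  (0 < N)%nat -> bern N (fun k => (t - INR k / INR N) ^ 2) t = t * (1 - t) / INR N.
Proof.
  intros HN; assert (HN' : INR N <> 0) by (apply not_0_INR; lia).
  rewrite (bern_ext _ _ _ (fun k => t * t + ((-2 * t / INR N) * INR k
            + (/ INR N * / INR N) * (INR k * INR k)))) by (intros; field; auto).
  rewrite !bern_plus, !bern_scal, bern_const, bern_INR, bern_INR_sqr; field; auto.
Qed.

Lemma is_derive_bern N t : forall c,
  is_derive (bern N c) t (INR N * bern (pred N) (fun k => c (S k) - c k) t).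
Proof.
  induction N as [|N IH]; intros c.
  { replace (_ * _) with 0 by (simpl; ring); apply @is_derive_const. }
  assert (H : is_derive (fun t => (1 - t) * bern N c t + t * bern N (fun k => c (S k)) t) t
    ((-1 * bern N c t + (1 - t) * (INR N * bern (pred N) (fun k => c (S k) - c k) t)) +
     (1 * bern N (fun k => c (S k)) t
      + t * (INR N * bern (pred N) (fun k => c (S (S k)) - c (S k)) t)))).
  { apply (is_derive_plus (V := R_NormedModule)).
    - apply (is_derive_mult (fun t => 1 - t) (bern N c)); [|apply IH|intros; apply Rmult_comm].
      auto_derive; [easy|ring].
    - apply (is_derive_mult (fun t => t) (bern N (fun k => c (S k))));
        [|apply (IH (fun k => c (S k)))|intros; apply Rmult_comm].
      auto_derive; [easy|ring]. }
  (* Unfolding [bern N] once requires [N > 0]; for [N = 0] the factor [INR N] makes both sides 0. *)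
  assert (HE : INR N * bern N (fun k => c (S k) - c k) t
    = INR N * ((1 - t) * bern (pred N) (fun k => c (S k) - c k) t
               + t * bern (pred N) (fun k => c (S (S k)) - c (S k)) t)).
  { destruct N as [|N]; [change (INR 0) with 0; ring|reflexivity]. }
  simpl pred; rewrite S_INR, Rmult_plus_distr_r, HE, (bern_minus N t (fun k => c (S k)) c).
  match type of H with is_derive _ _ ?l => match goal with |- is_derive _ _ ?l' =>
    replace l' with l by ring end end.
  exact H.
Qed.

Lemma bern_derivative_chain (N : nat) (c : nat -> R) (a b : R) :
  a < b -> exists g : nat -> R -> R,
    (forall x, g O x = bern N c ((x - a) / (b - a))) /\
    (forall k x, is_derive (g k) x (g (S k) x)) /\
    (forall k x, exists w, 0 <= w /\
       g k x = w * bern (N - k) (fdiff k c) ((x - a) / (b - a))).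
Proof.
  intros Hab.
  (* [w k] is [N (N - 1) ... (N - k + 1) / (b - a) ^ k], the factor coming from differentiating [k]
     times; truncated subtraction makes it 0 for [k > N]. *)
  set (w := fix w k := match k with O => 1 | S k' => w k' * (INR (N - k') / (b - a)) end).
  assert (Hw : forall k, 0 <= w k).
  { induction k as [|k IH]; simpl; [lra|].
    apply Rmult_le_pos; [easy|]; apply Rdiv_le_0_compat; [apply pos_INR|lra]. }
  exists (fun k x => w k * bern (N - k) (fdiff k c) ((x - a) / (b - a))); split; [|split].
  - intros x; simpl; rewrite Nat.sub_0_r; ring.
  - intros k x; simpl w; rewrite Rmult_assoc; apply is_derive_scal.
    replace (INR (N - k) / (b - a) * _) with
      (/ (b - a) * (INR (N - k) * bern (pred (N - k)) (fun j => fdiff k c (S j) - fdiff k c j)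
          ((x - a) / (b - a)))).
    + apply (is_derive_comp (V := R_NormedModule) (bern (N - k) (fdiff k c))
               (fun x => (x - a) / (b - a))); [apply is_derive_bern|].
      auto_derive; [lra|field; lra].
    + replace (N - S k)%nat with (pred (N - k)) by lia.
      rewrite (bern_ext _ _ (fdiff (S k) c) (fun j => fdiff k c (S j) - fdiff k c j))
        by (intros; apply fdiff_S).
      field; lra.
  - intros k x; now exists (w k).
Qed.

Lemma continuous_on_ab_bounded_unif f a b :
  a < b -> continuous_on_ab f a b ->
  (exists M, forall x, a <= x <= b -> Rabs (f x) <= M) /\
  (forall eps, 0 < eps -> exists delta, 0 < delta /\
     forall x y, a <= x <= b -> a <= y <= b -> Rabs (x - y) < delta ->
       Rabs (f x - f y) < eps).
Proof.
  intros Hab Hf.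
  set (fc := fun x => f (clamp a b x)).
  assert (Hfc : forall x, continuity_pt fc x).
  { intros x eps Heps.
    destruct (Hf (clamp a b x) (clamp_in a b x ltac:(lra)) eps Heps) as (d & Hd & H).
    exists d; split; [easy|]; intros y [_ Hy].
    apply H; [apply clamp_in; lra|].
    eapply Rle_lt_trans; [|exact Hy].
    simpl; unfold Rdist, clamp, Rmax, Rmin, Rabs.
    repeat destruct Rle_dec; repeat destruct Rcase_abs; lra. }
  assert (Hid : forall x, a <= x <= b -> f x = fc x).
  { intros x Hx; unfold fc; now rewrite clamp_id. }
  split.
  - destruct (continuous_bounded fc a b) as (M & _ & HM); [lra| |].
    + intros x; now apply continuity_pt_filterlim.
    + exists M; intros x Hx; rewrite Hid by easy; auto.
  - intros eps Heps.
    destruct (@Heine_cor2 fc a b (fun x _ => Hfc x) (mkposreal eps Heps)) as [d Hd].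
    exists d; split; [apply cond_pos|].
    intros x y Hx Hy Hxy; rewrite !Hid by easy; now apply Hd.
Qed.

(** Nearby points are handled by uniform continuity, distant ones by
    [2 * M <= 2 * M / d ^ 2 * (x - y) ^ 2]. A quadratic bound is what the Bernstein operator turns
    into a variance. *)
Lemma quadratic_modulus f a b :
  a < b -> continuous_on_ab f a b ->
  forall eps, 0 < eps -> exists A, 0 <= A /\
    forall x y, a <= x <= b -> a <= y <= b -> Rabs (f x - f y) <= eps + A * (x - y) ^ 2.
Proof.
  intros Hab Hf eps Heps.
  destruct (continuous_on_ab_bounded_unif f a b Hab Hf) as [[M HM] Hu].
  destruct (Hu eps Heps) as (d & Hd & H).
  assert (HM0 : 0 <= M) by (generalize (HM a ltac:(lra)) (Rabs_pos (f a)); lra).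
  exists (2 * M / d ^ 2); split.
  { apply Rdiv_le_0_compat; [lra|now apply pow_lt]. }
  intros x y Hx Hy.
  assert (Hsq : 0 <= 2 * M / d ^ 2 * (x - y) ^ 2).
  { apply Rmult_le_pos; [apply Rdiv_le_0_compat; [lra|now apply pow_lt]|apply pow2_ge_0]. }
  destruct (Rlt_dec (Rabs (x - y)) d) as [Hlt|Hge].
  - generalize (H x y Hx Hy Hlt); lra.
  - assert (Hd2 : d ^ 2 <= (x - y) ^ 2).
    { rewrite <- (pow2_abs (x - y)); apply pow_incr; lra. }
    assert (2 * M <= 2 * M / d ^ 2 * (x - y) ^ 2).
    { replace (2 * M) with (2 * M / d ^ 2 * d ^ 2) at 1 by (field; lra).
      apply Rmult_le_compat_l; [|easy].
      apply Rdiv_le_0_compat; [lra|now apply pow_lt]. }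
    assert (HfM : Rabs (f x - f y) <= 2 * M).
    { generalize (HM x Hx) (HM y Hy); unfold Rabs; repeat destruct Rcase_abs; lra. }
    lra.
Qed.

(* Bernstein polynomials converge uniformly and their derivatives of order [n + 1]
   have forward differences of [f] as coefficients, hence inherit [n]-convexity. *)
Lemma n_convex_smooth_approximation f a b n :
  a < b -> continuous_on_ab f a b -> n_convex n f a b ->
  forall eps, 0 < eps -> exists g : nat -> R -> R,
    (forall k x, is_derive (g k) x (g (S k) x)) /\
    (forall x, a <= x <= b -> Rabs (f x - g O x) <= eps) /\
    (forall x, a <= x <= b -> 0 <= g (S n) x).
Proof.
  intros Hab Hf Hconv eps Heps.
  destruct (quadratic_modulus f a b Hab Hf (eps / 2)) as (A & HA & Hmod); [lra|].
  destruct (INR_unbounded (A * (b - a) ^ 2 / (eps / 2))) as [N0 HN0].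
  (* [N0] makes the variance term at most [eps / 2]; adding [S n] lets the nodes [k, ..., k + S n]
     with [k <= N - S n] all stay in [[a, b]]. *)
  set (N := (N0 + S n)%nat).
  assert (HN : (0 < N)%nat) by (unfold N; lia).
  assert (HN' : 0 < INR N) by now apply lt_0_INR.
  assert (HNn : INR N0 <= INR N) by (apply le_INR; unfold N; lia).
  set (h := (b - a) / INR N).
  assert (Hh : 0 < h) by (apply Rdiv_lt_0_compat; lra).
  set (c := fun k => f (a + INR k * h)).
  assert (Hnode : forall k, (k <= N)%nat -> a <= a + INR k * h <= b).
  { intros k Hk; apply le_INR in Hk; assert (H0 := pos_INR k).
    assert (H1 : 0 <= INR k * h) by (apply Rmult_le_pos; lra).
    assert (H2 : INR k * h <= INR N * h) by (apply Rmult_le_compat_r; lra).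
    assert (H3 : INR N * h = b - a) by (unfold h; field; lra); lra. }
  destruct (bern_derivative_chain N c a b Hab) as (g & Hg0 & Hgd & Hgw).
  assert (Ht : forall x, a <= x <= b -> 0 <= (x - a) / (b - a) <= 1).
  { intros x Hx; split; [apply Rdiv_le_0_compat; lra|apply Rle_div_l; lra]. }
  exists g; split; [easy|split].
  - intros x Hx; rewrite Hg0.
    set (t := (x - a) / (b - a)) in *.
    assert (Htx := Ht x Hx); fold t in Htx.
    replace (f x - bern N c t) with (bern N (fun k => f x - c k) t)
      by now rewrite bern_minus, bern_const.
    apply Rle_trans with (bern N (fun k => eps / 2 + (A * (b - a) ^ 2) * (t - INR k / INR N) ^ 2) t).
    + apply bern_abs_le; [easy|]; intros k Hk.
      eapply Rle_trans; [apply (Hmod x (a + INR k * h)); auto|].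
      right; unfold t, h; field; lra.
    + rewrite bern_plus, bern_const, bern_scal, bern_variance by easy.
      assert (H1 : t * (1 - t) <= 1).
      { rewrite <- (Rmult_1_r 1); apply Rmult_le_compat; lra. }
      assert (HB : 0 <= A * (b - a) ^ 2) by (apply Rmult_le_pos; [easy|apply pow2_ge_0]).
      assert (H2 : A * (b - a) ^ 2 * (t * (1 - t) / INR N) <= A * (b - a) ^ 2 / INR N).
      { unfold Rdiv; apply Rmult_le_compat_l; [easy|].
        rewrite <- (Rmult_1_l (/ INR N)) at 2; apply Rmult_le_compat_r; [|easy].
        left; now apply Rinv_0_lt_compat. }
      assert (H3 : A * (b - a) ^ 2 / INR N <= eps / 2).
      { apply Rle_div_l; [lra|].
        apply Rmult_le_reg_r with (/ (eps / 2)); [apply Rinv_0_lt_compat; lra|].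
        replace (eps / 2 * INR N * / (eps / 2)) with (INR N) by (field; lra).
        unfold Rdiv in HN0 at 1; lra. }
      lra.
  - intros x Hx; destruct (Hgw (S n) x) as (w & Hw & ->).
    apply Rmult_le_pos; [easy|].
    apply Rle_trans with (bern (N - S n) (fun _ => 0) ((x - a) / (b - a)));
      [rewrite bern_const; lra|].
    apply bern_le; [auto|]; intros k Hk.
    replace k with (k + 0)%nat by lia; rewrite fdiff_shift.
    rewrite (fdiff_ext _ _ (fun j => f ((a + INR k * h) + INR j * h))).
    2:{ intros j _; unfold c; rewrite plus_INR; f_equal; ring. }
    apply (n_convex_fdiff n f a b); [easy|easy|apply Hnode; lia|].
    replace (a + INR k * h + INR (S n) * h) with (a + INR (k + S n) * h)
      by (rewrite plus_INR; ring).
    apply Hnode; lia.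
Qed.

(** * Test functions and the equivalence *)

Lemma J_ext F G a b k :
  (forall x, a <= x <= b -> F x = G x) ->
  forall x, a <= x <= b -> J k F a x = J k G a x.
Proof.
  intros H; induction k as [|k IH]; [exact H|].
  intros x Hx; simpl; apply RInt_ext.
  rewrite Rmin_left, Rmax_right by lra; intros y Hy; apply IH; lra.
Qed.

Lemma J_minus F G a k x :
  integrable_mult F -> integrable_mult G ->
  J k (fun x => F x - G x) a x = J k F a x - J k G a x.
Proof.
  intros HF HG; revert x; induction k as [|k IH]; intros x; [easy|].
  simpl; rewrite (RInt_ext _ _ _ _ (fun y _ => IH y)).
  apply (RInt_minus (V := R_CompleteNormedModule));
    now apply integrable_mult_ex_RInt, integrable_mult_J.
Qed.

Lemma continuous_J h b k x : (forall x, continuous h x) -> continuous (J k h b) x.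
Proof.
  intros Hh; destruct k as [|k]; [apply Hh|].
  apply (integrable_mult_J h b (S k)); [now apply integrable_mult_continuous|lia].
Qed.

Lemma is_derive_J h b k x :
  (forall x, continuous h x) -> is_derive (J (S k) h b) x (J k h b x).
Proof.
  intros Hh; apply (is_derive_RInt (J k h b) (J (S k) h b) b x); [|now apply continuous_J].
  apply filter_forall; intros y; apply (RInt_correct (V := R_CompleteNormedModule)).
  apply ex_RInt_continuous_R; intros; now apply continuous_J.
Qed.

Lemma J_S_base k h b : J (S k) h b b = 0.
Proof. exact (RInt_point (V := R_CompleteNormedModule) b (J k h b)). Qed.

(** The integrals over [[a, y]] and [[y, b]] are nonnegative with sum at most 0, so the primitive of
    [u] vanishes on [(a, b)], and so does its derivative [u]. *)
Lemma RInt_nonpos_eq_0 (u : R -> R) a b :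
  (forall x, continuous u x) -> (forall x, 0 <= u x) -> RInt u a b <= 0 ->
  forall x, a < x < b -> u x = 0.
Proof.
  intros Hu Hpos Hint x Hx.
  assert (Hi : forall c d, ex_RInt u c d) by (intros; now apply ex_RInt_continuous_R).
  assert (HJ : forall y, a < y < b -> J 1 u a y = 0).
  { intros y Hy; simpl; rewrite (RInt_Chasles_R u a y b) in Hint by auto.
    generalize (RInt_ge_0 u a y ltac:(lra) (Hi a y) (fun z _ => Hpos z))
               (RInt_ge_0 u y b ltac:(lra) (Hi y b) (fun z _ => Hpos z)); lra. }
  assert (Hd := is_derive_J u a 0 x Hu); simpl J at 2 in Hd.
  apply (is_derive_ext_loc _ (fun _ => 0)) in Hd.
  - apply is_derive_unique in Hd; rewrite Derive_const in Hd; lra.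
  - apply (locally_interval _ x a b); simpl; try lra.
    intros y H1 H2; apply HJ; simpl in *; lra.
Qed.

Lemma continuous_on_ab_continuous (f : R -> R) a b :
  (forall x, continuous f x) -> continuous_on_ab f a b.
Proof.
  intros Hf x _ eps Heps.
  assert (H := proj1 (filterlim_locally f (f x)) (Hf x) (mkposreal eps Heps)).
  destruct H as [d Hd]; exists d; split; [apply cond_pos|].
  intros y _ Hy; now apply Hd.
Qed.

Lemma C1_RSInt_value_minus g g' F1 F2 v1 v2 a b :
  (forall s, continuous g' s) -> controlled F1 v1 -> controlled F2 v2 -> F1 a = F2 a ->
  (g b * F2 b - g a * F2 a - RInt (fun s => g' s * F2 s) a b)
  - (g b * F1 b - g a * F1 a - RInt (fun s => g' s * F1 s) a b)
  = g b * (F2 b - F1 b) - RInt (fun s => g' s * (F2 s - F1 s)) a b.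
Proof.
  intros Hc H1 H2 Ha.
  rewrite (RInt_ext (fun s => g' s * (F2 s - F1 s))
             (fun s => minus (g' s * F2 s) (g' s * F1 s))).
  2:{ intros s _; unfold minus, plus, opp; simpl; ring. }
  rewrite (RInt_minus (V := R_CompleteNormedModule));
    [|now apply ex_RInt_mult_controlled with v2|now apply ex_RInt_mult_controlled with v1].
  unfold minus, plus, opp; simpl; rewrite Ha; ring.
Qed.

Definition RS_dominated (n : nat) (a b : R) (F1 F2 : R -> R) : Prop :=
  forall f : R -> R, continuous_on_ab f a b -> n_convex n f a b ->
    forall I1 I2, is_RSInt f F1 a b I1 -> is_RSInt f F2 a b I2 -> I1 <= I2.

Lemma RS_dominated_smooth n a b F1 F2 v1 v2 (g : nat -> R -> R) :
  a < b -> controlled F1 v1 -> controlled F2 v2 -> F1 a = F2 a ->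
  RS_dominated n a b F1 F2 ->
  (forall k x, (k <= n)%nat -> is_derive (g k) x (g (S k) x)) ->
  (forall x, continuous (g 1%nat) x) ->
  (forall x, a <= x <= b -> 0 <= g (S n) x) ->
  0 <= g O b * (F2 b - F1 b) - RInt (fun s => g 1%nat s * (F2 s - F1 s)) a b.
Proof.
  intros Hab H1 H2 Ha Hdom Hg Hc Hpos.
  rewrite <- (C1_RSInt_value_minus (g O) (g 1%nat) F1 F2 v1 v2 a b) by easy.
  apply Rge_le, Rge_minus, Rle_ge.
  assert (Hd : forall s, is_derive (g O) s (g 1%nat s)) by (intros; apply Hg; lia).
  apply (Hdom (g O)).
  - apply continuous_on_ab_continuous; intros x.
    apply (ex_derive_continuous (g O)); eexists; apply Hd.
  - now apply n_convex_of_derivative.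
  - now apply is_RSInt_C1 with v1.
  - now apply is_RSInt_C1 with v2.
Qed.

(* Test functions [c (x - b)^k / k!] with [c = 1] and [c = -1], written as iterated
   primitives based at [b]. *)
Lemma RS_dominated_moments n a b F1 F2 v1 v2 k :
  a < b -> controlled F1 v1 -> controlled F2 v2 -> F1 a = F2 a ->
  RS_dominated n a b F1 F2 -> (k <= n)%nat ->
  J k (fun x => F2 x - F1 x) a b = 0.
Proof.
  intros Hab H1 H2 Ha Hdom Hk.
  set (G := fun x => F2 x - F1 x).
  assert (HG : integrable_mult G).
  { intros u Hu c d; apply (ex_RInt_mult_controlled u G (fun x => v1 x + v2 x)); [easy|].
    now apply controlled_minus. }
  assert (H : forall c, 0 <= (-1) ^ k * (c * J k G a b)).
  { intros c.
    set (g := fun i x => if Nat.leb i k then J (k - i) (fun _ => c) b x else 0).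
    assert (Hcc : forall x, continuous (fun _ : R => c) x) by (intros; apply continuous_const).
    assert (Hg : forall i x, is_derive (g i) x (g (S i) x)).
    { intros i x; unfold g.
      destruct (Nat.leb_spec i k) as [Hi|Hi]; destruct (Nat.leb_spec (S i) k) as [Hi'|Hi']; try lia.
      - replace (k - i)%nat with (S (k - S i)) by lia; now apply is_derive_J.
      - replace (k - i)%nat with O by lia; exact (is_derive_const (V := R_NormedModule) c x).
      - exact (is_derive_const (V := R_NormedModule) 0 x). }
    assert (Hgc : forall i x, continuous (g i) x).
    { intros i x; apply (ex_derive_continuous (g i)); eexists; apply Hg. }
    assert (Hpos : forall x, a <= x <= b -> 0 <= g (S n) x).
    { intros x _; unfold g; rewrite (proj2 (Nat.leb_gt (S n) k)) by lia; lra. }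
    assert (H0 := RS_dominated_smooth n a b F1 F2 v1 v2 g Hab H1 H2 Ha Hdom
                    (fun i x _ => Hg i x) (Hgc 1%nat) Hpos).
    fold (G b) in H0.
    change (fun s => g 1%nat s * (F2 s - F1 s)) with (fun s => g 1%nat s * G s) in H0.
    (* Depth [k], not [n]: derivatives of order below [k] vanish at [b] and the one of order [k + 1]
       is 0, which leaves only [(-1) ^ k * (c * J k G a b)]. *)
    rewrite (iterated_by_parts g G a b k) in H0; auto.
    - assert (Hz : forall x, g (S k) x = 0).
      { intros x; unfold g; now rewrite (proj2 (Nat.leb_gt (S k) k)) by lia. }
      rewrite (RInt_ext (fun s => g (S k) s * J k G a s) (fun _ => 0)) in H0
        by (intros; rewrite Hz; apply Rmult_0_l).
      rewrite RInt_const in H0; unfold scal in H0; simpl in H0; unfold mult in H0; simpl in H0.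
      unfold g in H0 at 1; rewrite Nat.leb_refl, Nat.sub_diag in H0; simpl in H0.
      rewrite Rmult_0_r, Rminus_0_r in H0; exact H0.
    - intros i Hi; unfold g; rewrite (proj2 (Nat.leb_le i k)) by lia.
      replace (k - i)%nat with (S (k - S i)) by lia; rewrite J_S_base; ring. }
  assert (Hn : (-1) ^ k <> 0) by (apply pow_nonzero; lra).
  apply Rmult_eq_reg_l with ((-1) ^ k); [|easy].
  generalize (H 1) (H (-1)); lra.
Qed.

Lemma RS_dominated_sign n a b F1 F2 v1 v2 x :
  a < b -> (1 <= n)%nat -> controlled F1 v1 -> controlled F2 v2 -> F1 a = F2 a ->
  RS_dominated n a b F1 F2 -> a < x < b ->
  0 <= (-1) ^ S n * J n (fun x => F2 x - F1 x) a x.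
Proof.
  intros Hab Hn H1 H2 Ha Hdom Hx.
  set (G := fun x => F2 x - F1 x).
  assert (HG : integrable_mult G).
  { intros u Hu c d; apply (ex_RInt_mult_controlled u G (fun x => v1 x + v2 x)); [easy|].
    now apply controlled_minus. }
  set (w := fun x => (-1) ^ S n * J n G a x).
  (* The test function has the negative part of [w] as derivative of order [n + 1]. *)
  set (h := fun x => (Rabs (w x) - w x) / 2).
  assert (Hw : forall x, continuous w x).
  { intros y; apply (continuous_mult (fun _ => (-1) ^ S n) (J n G a)); [apply continuous_const|].
    now apply integrable_mult_J. }
  assert (Hh : forall x, continuous h x).
  { intros y; apply (continuous_mult (fun x => Rabs (w x) - w x) (fun _ => / 2));
      [|apply continuous_const].
    apply (continuous_minus (fun x => Rabs (w x)) w); [|apply Hw].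
    apply (continuous_comp w Rabs); [apply Hw|apply continuous_Rabs]. }
  (* Based at [b], all [g i] with [i <= n] vanish there, so every boundary term disappears. *)
  set (g := fun i => J (S n - i) h b).
  assert (Hg : forall i x, (i <= n)%nat -> is_derive (g i) x (g (S i) x)).
  { intros i y Hi; unfold g; replace (S n - i)%nat with (S (S n - S i)) by lia.
    now apply is_derive_J. }
  assert (Hgn : forall x, g (S n) x = h x) by (intros; unfold g; now rewrite Nat.sub_diag).
  assert (Hgc : forall i x, continuous (g i) x) by (intros; now apply continuous_J).
  assert (Hneg : forall s, 0 <= h s).
  { intros s; unfold h; generalize (Rle_abs (w s)); lra. }
  assert (Hpos : forall x, a <= x <= b -> 0 <= g (S n) x) by (intros; now rewrite Hgn).
  assert (H0 := RS_dominated_smooth n a b F1 F2 v1 v2 g Hab H1 H2 Ha Hdom Hg (Hgc 1%nat) Hpos).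
  fold (G b) in H0.
  change (fun s => g 1%nat s * (F2 s - F1 s)) with (fun s => g 1%nat s * G s) in H0.
  rewrite (iterated_by_parts g G a b n) in H0; auto.
  - assert (Hb : g n b = 0).
    { unfold g; replace (S n - n)%nat with 1%nat by lia; apply J_S_base. }
    assert (Hint : (-1) ^ n * (g n b * J n G a b - RInt (fun s => g (S n) s * J n G a s) a b)
                   = - RInt (fun s => h s * h s) a b).
    { rewrite Hb.
      replace (_ * _) with ((-1) ^ S n * RInt (fun s => g (S n) s * J n G a s) a b)
        by (simpl; ring).
      rewrite <- (RInt_scal (V := R_CompleteNormedModule)), <- (RInt_opp (V := R_CompleteNormedModule)).
      - apply RInt_ext; intros s _; rewrite Hgn; unfold scal, opp; simpl; unfold mult; simpl.
        replace (_ * (h s * J n G a s)) with (h s * w s) by (unfold w; simpl; ring).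
        (* Pointwise [h * w = - h * h]: either [h = 0], or [w < 0] and [h = - w]. *)
        unfold h, Rabs; destruct Rcase_abs; field.
      - apply ex_RInt_continuous_R; intros; now apply (continuous_mult h h).
      - apply integrable_mult_J; auto. }
    rewrite Hint in H0.
    assert (Hh0 : h x * h x = 0).
    { apply (RInt_nonpos_eq_0 (fun s => h s * h s) a b); auto.
      - intros; now apply (continuous_mult h h).
      - intros; now apply Rmult_le_pos.
      - lra. }
    apply Rmult_integral in Hh0; change (0 <= w x).
    generalize (Rabs_pos (w x)); unfold h in Hh0; lra.
  - intros i Hi; unfold g; replace (S n - i)%nat with (S (n - i)) by lia.
    rewrite J_S_base; ring.
Qed.

Lemma RS_dominated_sufficient n a b F1 F2 v1 v2 :
  a < b -> controlled F1 v1 -> controlled F2 v2 -> F1 a = F2 a ->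
  (forall k, (k <= n)%nat -> J k (fun x => F2 x - F1 x) a b = 0) ->
  (forall x, a < x < b -> 0 <= (-1) ^ S n * J n (fun x => F2 x - F1 x) a x) ->
  RS_dominated n a b F1 F2.
Proof.
  intros Hab H1 H2 Ha Hmom Hsign f Hf Hconv I1 I2 HI1 HI2.
  set (G := fun x => F2 x - F1 x) in *.
  set (v := fun x => v1 x + v2 x).
  assert (HGv : controlled G v) by now apply controlled_minus.
  assert (HG : integrable_mult G).
  { intros u Hu c d; now apply (ex_RInt_mult_controlled u G v). }
  set (V := v b - v a).
  assert (HV : 0 <= V).
  { unfold V; generalize (HGv a b ltac:(lra)) (Rabs_pos (G b - G a)); lra. }
  apply Rle_plus_epsilon; intros eps Heps.
  (* Replacing [f] by [g] changes sums against [G] by at most [eta * V <= eps / 2]; the 1 covers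
     [V = 0]. *)
  set (eta := eps / (2 * (V + 1))).
  assert (Heta : 0 < eta) by (apply Rdiv_lt_0_compat; lra).
  assert (HetaV : eta * V <= eps / 2).
  { replace (eps / 2) with (eta * (V + 1)) by (unfold eta; field; lra).
    apply Rmult_le_compat_l; lra. }
  destruct (n_convex_smooth_approximation f a b n Hab Hf Hconv eta Heta)
    as (g & Hg & Happ & Hpos).
  assert (Hgc : forall i x, continuous (g i) x).
  { intros i x; apply (ex_derive_continuous (g i)); eexists; apply Hg. }
  assert (HP1 := is_RSInt_C1 (g O) (g 1%nat) F1 v1 a b Hab (Hg O) (Hgc 1%nat) H1).
  assert (HP2 := is_RSInt_C1 (g O) (g 1%nat) F2 v2 a b Hab (Hg O) (Hgc 1%nat) H2).
  assert (HP := C1_RSInt_value_minus (g O) (g 1%nat) F1 F2 v1 v2 a b (Hgc 1%nat) H1 H2 Ha).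
  set (P1 := g O b * F1 b - _ - _) in *; set (P2 := g O b * F2 b - _ - _) in *.
  assert (HP0 : 0 <= P2 - P1).
  { rewrite HP; fold (G b).
    change (fun s => g 1%nat s * (F2 s - F1 s)) with (fun s => g 1%nat s * G s).
    rewrite (iterated_by_parts g G a b n); auto.
    - rewrite Hmom, Rmult_0_r by lia.
      replace (_ * _) with ((-1) ^ S n * RInt (fun s => g (S n) s * J n G a s) a b)
        by (simpl; ring).
      assert (Hi : ex_RInt (fun s => g (S n) s * J n G a s) a b) by now apply integrable_mult_J.
      rewrite <- (RInt_scal (V := R_CompleteNormedModule)) by easy.
      apply RInt_ge_0; [lra|now apply (ex_RInt_scal (V := R_NormedModule))|].
      intros s Hs; unfold scal; simpl; unfold mult; simpl.
      replace (_ * (g (S n) s * J n G a s)) with (g (S n) s * ((-1) ^ S n * J n G a s))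
        by (simpl; ring).
      apply Rmult_le_pos; [apply Hpos; lra|now apply Hsign].
    - intros i Hi; rewrite Hmom by lia; ring. }
  (* Four integrals, of [f] and [g] against [F1] and [F2], are each within [eps / 8] of their sums
     on one partition: [eps / 2] in all, the other half being [eta * V]. *)
  assert (He : 0 < eps / 8) by lra.
  destruct (HI1 _ He) as (d1 & Hd1 & HI1'); destruct (HI2 _ He) as (d2 & Hd2 & HI2').
  destruct (HP1 _ He) as (d3 & Hd3 & HP1'); destruct (HP2 _ He) as (d4 & Hd4 & HP2').
  destruct (uniform_mesh_small a b (Rmin (Rmin d1 d2) (Rmin d3 d4)) Hab) as (N & HN & Hmesh).
  { repeat apply Rmin_glb_lt; easy. }
  assert (Hpart := uniform_node_partition a b N Hab HN).
  set (p := uniform_node a b N) in *.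
  assert (Hstep : forall d, Rmin (Rmin d1 d2) (Rmin d3 d4) <= d ->
            forall i, (i < N)%nat -> p (S i) - p i < d).
  { intros d Hd i _; unfold p; rewrite uniform_node_step; lra. }
  assert (Htag : forall i, (i < N)%nat -> p i <= p i <= p (S i)).
  { intros i Hi; generalize (proj2 (proj2 Hpart) i Hi); lra. }
  assert (Hm1 := Rmin_l (Rmin d1 d2) (Rmin d3 d4)); assert (Hm2 := Rmin_r (Rmin d1 d2) (Rmin d3 d4)).
  assert (Hm3 := Rmin_l d1 d2); assert (Hm4 := Rmin_r d1 d2).
  assert (Hm5 := Rmin_l d3 d4); assert (Hm6 := Rmin_r d3 d4).
  specialize (HI1' N p p Hpart Htag (Hstep d1 ltac:(lra))).
  specialize (HI2' N p p Hpart Htag (Hstep d2 ltac:(lra))).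
  specialize (HP1' N p p Hpart Htag (Hstep d3 ltac:(lra))).
  specialize (HP2' N p p Hpart Htag (Hstep d4 ltac:(lra))).
  assert (HB := RS_sum_bound (fun x => f x - g O x) G v a b eta N p p HGv Hpart Htag Happ).
  rewrite <- RS_sum_minus_l in HB; unfold G in HB; rewrite <- !RS_sum_minus_r in HB.
  fold V in HB.
  apply Rabs_def2 in HI1', HI2', HP1', HP2'; apply Rabs_le_between in HB; lra.
Qed.

Theorem theorem2p1 (a b : R) (n : nat) (F1 F2 : R -> R) :
  a < b -> (1 <= n)%nat ->
  BV_on F1 a b -> BV_on F2 a b ->
  F1 a = F2 a ->
  ((forall f : R -> R, continuous_on_ab f a b -> n_convex n f a b ->
      forall I1 I2, is_RSInt f F1 a b I1 -> is_RSInt f F2 a b I2 -> I1 <= I2)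
   <->
   (F1 b = F2 b /\
    RInt F1 a b = RInt F2 a b /\
    (forall k, (2 <= k <= n)%nat -> J k F1 a b = J k F2 a b) /\
    (forall x, a < x < b ->
       (-1) ^ (S n) * J n F1 a x <= (-1) ^ (S n) * J n F2 a x))).
Proof.
  intros Hab Hn HF1 HF2 Ha.
  destruct (BV_on_controlled F1 a b ltac:(lra) HF1) as [v1 H1].
  destruct (BV_on_controlled F2 a b ltac:(lra) HF2) as [v2 H2].
  set (C1 := fun x => F1 (clamp a b x)) in *; set (C2 := fun x => F2 (clamp a b x)) in *.
  assert (Ha' : C1 a = C2 a) by (unfold C1, C2; rewrite !clamp_id by lra; easy).
  (* For [x] in [[a, b]] the iterated primitives read only values on [[a, b]], which clamping leaves
     unchanged. *)
  assert (HJ : forall k x, a <= x <= b ->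
            J k (fun x => C2 x - C1 x) a x = J k F2 a x - J k F1 a x).
  { intros k x Hx; rewrite J_minus.
    - rewrite (J_ext F1 C1 a b), (J_ext F2 C2 a b); auto;
        intros y Hy; unfold C1, C2; now rewrite clamp_id.
    - intros u Hu c d; now apply ex_RInt_mult_controlled with v2.
    - intros u Hu c d; now apply ex_RInt_mult_controlled with v1. }
  split.
  - intros H.
    assert (Hdom : RS_dominated n a b C1 C2).
    { intros f Hf Hc I1 I2 HI1 HI2; apply (H f Hf Hc).
      - now apply is_RSInt_clamp.
      - now apply is_RSInt_clamp. }
    assert (Hmom : forall k, (k <= n)%nat -> J k F1 a b = J k F2 a b).
    { intros k Hk; assert (Hz := RS_dominated_moments n a b C1 C2 v1 v2 k Hab H1 H2 Ha' Hdom Hk).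
      rewrite HJ in Hz by lra; lra. }
    split; [apply (Hmom O); lia|split; [now apply (Hmom 1%nat)|split]].
    + intros k Hk; apply Hmom; lia.
    + intros x Hx.
      assert (Hs := RS_dominated_sign n a b C1 C2 v1 v2 x Hab Hn H1 H2 Ha' Hdom Hx).
      rewrite HJ in Hs by lra; lra.
  - intros (Hb & Hi & Hk & Hs).
    assert (Hdom : RS_dominated n a b C1 C2).
    { apply (RS_dominated_sufficient n a b C1 C2 v1 v2); auto.
      (* Conditions (i), (ii) and (iii) are the vanishing of the moments of order 0, 1 and at least
         2. *)
      - intros [|[|k]] Hk'; rewrite HJ by lra.
        + simpl; lra.
        + change (RInt F2 a b - RInt F1 a b = 0); lra.
        + rewrite Hk by lia; lra.
      - intros x Hx; rewrite HJ by lra; generalize (Hs x Hx); lra. }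
    intros f Hf Hc I1 I2 HI1 HI2.
    apply (Hdom f Hf Hc); now apply is_RSInt_clamp.
Qed.
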